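(* Let $(E,\theta)$ be a regular semisimple Higgs bundle on a smooth complex projective curve $X$ with smooth spectral curve $\pi\colon Y\hookrightarrow \mathrm{Tot}(\Omega_X^1)\to X$ and spectral line bundle $L$ on $Y$, so that $E\cong\pi_*L$. Let $\Delta\subset X$ be the discriminant divisor, $X^\circ:=X\setminus\Delta$, $j\colon X^\circ\hookrightarrow X$ the inclusion, $Y^\circ:=\pi^{-1}(X^\circ)$, $\pi^\circ\colon Y^\circ\to X^\circ$ the induced finite étale map, and $m^\circ\colon\pi^\circ_*\mathcal{O}_{Y^\circ}\to\mathrm{End}(E|_{X^\circ})$ the multiplication map. Then the map of coefficient sheaves $$\mathrm{id}\otimes m^\circ\colon \Omega^1_{X^\circ}\otimes\pi^\circ_*\mathcal{O}_{Y^\circ}\longrightarrow\Omega^1_{X^\circ}\otimes\mathrm{End}(E|_{X^\circ})$$ sends the scalar form $\beta^\circ_{\mathrm{spec}}(L,\pi)$ of the restricted spectral Atiyah class to the restriction of the Atiyah class of $E$: $$(\mathrm{id}\otimes m^\circ)_*\beta^\circ_{\mathrm{spec}}(L,\pi)=j^*\mathrm{At}(E)\qquad\text{in } H^1\bigl(X^\circ,\Omega^1_{X^\circ}\otimes\mathrm{End}(E|_{X^\circ})\bigr).$$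
   Context: A Higgs bundle $(E,\theta)$ on $X$ is a vector bundle $E$ with an $\mathcal{O}_X$-linear map $\theta\colon E\to E\otimes\Omega_X^1$. Regular semisimple means that $\theta$ has pairwise distinct eigenvalues generically, i.e. the discriminant of its characteristic polynomial is not identically zero. The spectral curve $Y\subset\mathrm{Tot}(\Omega_X^1)$ is the zero scheme of the characteristic polynomial of $\theta$, assumed smooth; $\pi\colon Y\to X$ is the (finite) projection. By the Beauville–Narasimhan–Ramanan correspondence there is a line bundle $L$ on $Y$ (the spectral line bundle) with $E\cong\pi_*L$, such that $\theta$ is the pushforward of multiplication by the tautological section of $\pi^*\Omega_X^1$ on $Y$. The discriminant divisor $\Delta\subset X$ is the divisor cut out by the discriminant of the characteristic polynomial (equivalently, the branch divisor of $\pi$); $\pi$ is finite étale over $X\setminus\Delta$. $\mathrm{End}$ of a bundle denotes its sheaf of endomorphisms. The multiplication map $m\colon\pi_*\mathcal{O}_Y\to\mathrm{End}(E)$ is the action of $\pi_*\mathcal{O}_Y$ on $E\cong\pi_*L$ by multiplication of sections; $m^\circ$ is its restriction to $X^\circ$. For a vector bundle $F$ on a smooth complex curve $C$, the Atiyah class $\mathrm{At}(F)\in\mathrm{Ext}^1_C(F,\Omega_C^1\otimes F)\cong H^1(C,\Omega_C^1\otimes\mathrm{End}(F))$ is the extension class of the first jet sequence $0\to\Omega_C^1\otimes F\to J_C^1(F)\to F\to0$, where $J_C^1(F)$ is the bundle of first-order jets. For a line bundle it lies in $H^1(C,\Omega_C^1)$, via $\mathrm{End}(F)\cong\mathcal{O}_C$.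 Definition of $\beta^\circ_{\mathrm{spec}}(L,\pi)$: put $L^\circ:=L|_{Y^\circ}$. Then $\beta^\circ_{\mathrm{spec}}(L,\pi)\in H^1(X^\circ,\Omega^1_{X^\circ}\otimes\pi^\circ_*\mathcal{O}_{Y^\circ})$ is the class corresponding to $\mathrm{At}(L^\circ)\in H^1(Y^\circ,\Omega^1_{Y^\circ})$ under the canonical isomorphisms $$H^1(Y^\circ,\Omega^1_{Y^\circ})\cong H^1(Y^\circ,\pi^{\circ*}\Omega^1_{X^\circ})\cong H^1(X^\circ,\Omega^1_{X^\circ}\otimes\pi^\circ_*\mathcal{O}_{Y^\circ}),$$ given by the étale identification $\pi^{\circ*}\Omega^1_{X^\circ}\cong\Omega^1_{Y^\circ}$ and by finiteness of $\pi^\circ$ together with the projection formula. *)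

(* Defs.v *)
From HB Require Import structures.
From mathcomp Require Import all_boot all_order all_algebra.
From mathcomp Require Import complex.
From mathcomp Require Import boolp classical_sets reals topology.

Set Implicit Arguments.
Unset Strict Implicit.
Unset Printing Implicit Defensive.
Import GRing.Theory.
Local Open Scope classical_set_scope.
Local Open Scope ring_scope.
Local Open Scope quotient_scope.
Local Obligation Tactic := idtac.

Record opens (T : topologicalType) := Opens {
  oset :> set T;
  oset_open : open oset }.

Definition otop (T : topologicalType) : opens T := Opens openT.

Definition ocap (T : topologicalType) (U V : opens T) : opens T :=
  Opens (openI (oset_open U) (oset_open V)).

Notation "V <=o U" := (oset V `<=` oset U) (at level 70, no associativity).

Lemma sub_otop (T : topologicalType) (U : opens T) : U <=o otop T.
Proof. by []. Qed.

Lemma subo_refl (T : topologicalType) (U : opens T) : U <=o U.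
Proof. by []. Qed.

(* comPzRingType, because the sections over the empty set form the zero ring. *)
Record ringed_space (k : fieldType) := RingedSpace {
  pt :> topologicalType;
  OO : opens pt -> comPzRingType;
  resO : forall U V : opens pt, V <=o U -> {rmorphism OO U -> OO V};
  cst : forall U : opens pt, {rmorphism k -> OO U};
  resO_id : forall (U : opens pt) (h : U <=o U) (f : OO U), resO h f = f;
  resO_comp : forall (U V W : opens pt) (hV : V <=o U) (hW : W <=o V)
    (h : W <=o U) (f : OO U), resO hW (resO hV f) = resO h f;
  resO_cst : forall (U V : opens pt) (h : V <=o U) (c : k),
    resO h (cst U c) = cst V c }.

Arguments OO {k} _ _.
Arguments resO {k _ U V} _.
Arguments cst {k _} U.

(* Presheaves of O-modules; the sheaf axiom is the predicate [is_sheaf]. *)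
Record pmod (k : fieldType) (X : ringed_space k) := PMod {
  sec :> forall U : opens X, lmodType (OO X U);
  res : forall U V : opens X, V <=o U -> {additive sec U -> sec V};
  resZ : forall (U V : opens X) (h : V <=o U) (a : OO X U) (m : sec U),
    res h (a *: m) = resO h a *: res h m;
  res_id : forall (U : opens X) (h : U <=o U) (m : sec U), res h m = m;
  res_comp : forall (U V W : opens X) (hV : V <=o U) (hW : W <=o V)
    (h : W <=o U) (m : sec U), res hW (res hV m) = res h m }.

Arguments res {k X} _ {U V} _.

Section Modules.
Variables (k : fieldType) (X : ringed_space k).
Implicit Types (U V W : opens X) (M N : pmod X).

Definition is_sheaf M : Prop :=
  forall (U : opens X) (I : Type) (V : I -> opens X)
    (hV : forall i, V i <=o U) (s : forall i, M (V i)),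
  (forall x, oset U x -> exists i, oset (V i) x) ->
  (forall i j W (hi : W <=o V i) (hj : W <=o V j),
     res M hi (s i) = res M hj (s j)) ->
  exists! t : M U, forall i, res M (hV i) t = s i.

Definition is_frame M U (r : nat) (e : 'I_r -> M U) : Prop :=
  forall V (h : V <=o U) (m : M V),
  exists! c : 'I_r -> OO X V, m = \sum_(i < r) c i *: res M h (e i).

Definition is_generator M U (m : M U) : Prop :=
  is_frame (fun _ : 'I_1 => m).

Definition locally_free M (r : nat) : Prop :=
  forall x : X, exists (U : opens X) (e : 'I_r -> M U),
    oset U x /\ is_frame e.

Definition vector_bundle M (r : nat) : Prop := is_sheaf M /\ locally_free M r.

Definition line_bundle M : Prop := vector_bundle M 1.

Section StructureSheaf.
Definition resR U V (h : V <=o U) : (OO X U)^o -> (OO X V)^o := resO h.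
Fact resR_additive U V (h : V <=o U) : zmod_morphism (resR h).
Proof. by move=> a b; rewrite /resR rmorphB. Qed.
HB.instance Definition _ U V (h : V <=o U) :=
  GRing.isZmodMorphism.Build _ _ (resR h) (resR_additive h).
Fact resRZ U V (h : V <=o U) (a : OO X U) (m : (OO X U)^o) :
  resR h (a *: m) = resO h a *: resR h m.
Proof. exact: rmorphM. Qed.
Fact resR_id U (h : U <=o U) (m : (OO X U)^o) : resR h m = m.
Proof. exact: resO_id. Qed.
Fact resR_comp U V W (hV : V <=o U) (hW : W <=o V) (h : W <=o U)
  (m : (OO X U)^o) : resR hW (resR hV m) = resR h m.
Proof. exact: resO_comp. Qed.
Definition Omod : pmod X :=
  @PMod k X (fun U => (OO X U)^o) (fun U V h => resR h) resRZ resR_id resR_comp.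
End StructureSheaf.

Section Hom.
Variables M N : pmod X.

(* Sections of Hom(M, N) over W, i.e. morphisms M|_W -> N|_W. *)
Record homs (W : opens X) := Homs {
  hom_fun :> forall V, V <=o W -> M V -> N V;
  hom_lin : forall V (h : V <=o W) (a : OO X V) (m n : M V),
    hom_fun h (a *: m + n) = a *: hom_fun h m + hom_fun h n;
  hom_nat : forall V V' (h : V <=o W) (h' : V' <=o V) (h'' : V' <=o W)
    (m : M V), res N h' (hom_fun h m) = hom_fun h'' (res M h' m) }.

Lemma homs_eq W (f g : homs W) :
  (forall V (h : V <=o W) m, f V h m = g V h m) -> f = g.
Proof.
case: f g => [f fl fn] [g gl gn] /= fg.
have E : f = g.
  apply: functional_extensionality_dep => V.
  apply: functional_extensionality_dep => h.
  by apply: functional_extensionality_dep => m.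
by case: _ / E gl gn => gl gn; congr Homs; apply: Prop_irrelevance.
Qed.

HB.instance Definition _ W := gen_eqMixin (homs W).
HB.instance Definition _ W := gen_choiceMixin (homs W).

Program Definition hom_zero W : homs W := @Homs W (fun V h m => 0) _ _.
Next Obligation. by move=> * /=; rewrite scaler0 addr0. Qed.
Next Obligation. by move=> * /=; rewrite raddf0. Qed.

Program Definition hom_opp W (f : homs W) : homs W :=
  @Homs W (fun V h m => - f V h m) _ _.
Next Obligation. by move=> * /=; rewrite hom_lin opprD scalerN. Qed.
Next Obligation. by move=> W f V V' h h' h'' m /=; rewrite raddfN (hom_nat _ _ h' _). Qed.

Program Definition hom_add W (f g : homs W) : homs W :=
  @Homs W (fun V h m => f V h m + g V h m) _ _.
Next Obligation. by move=> * /=; rewrite !hom_lin scalerDr addrACA. Qed.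
Next Obligation. by move=> W f g V V' h h' h'' m /=; rewrite raddfD !(hom_nat _ h h' h''). Qed.

Program Definition hom_scale W (a : OO X W) (f : homs W) : homs W :=
  @Homs W (fun V h m => resO h a *: f V h m) _ _.
Next Obligation.
by move=> * /=; rewrite hom_lin scalerDr !scalerA mulrC.
Qed.
Next Obligation.
by move=> W a f V V' h h' h'' m /=; rewrite resZ (resO_comp h h' h'') (hom_nat _ h h' h'').
Qed.

Fact hom_addA W : associative (@hom_add W).
Proof. by move=> f g h; apply: homs_eq => *; apply: addrA. Qed.
Fact hom_addC W : commutative (@hom_add W).
Proof. by move=> f g; apply: homs_eq => *; apply: addrC. Qed.
Fact hom_add0 W : left_id (@hom_zero W) (@hom_add W).
Proof. by move=> f; apply: homs_eq => *; apply: add0r. Qed.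
Fact hom_addN W : left_inverse (@hom_zero W) (@hom_opp W) (@hom_add W).
Proof. by move=> f; apply: homs_eq => *; apply: addNr. Qed.
HB.instance Definition _ W := GRing.isZmodule.Build (homs W)
  (@hom_addA W) (@hom_addC W) (@hom_add0 W) (@hom_addN W).

Fact hom_scaleA W a b (f : homs W) :
  hom_scale a (hom_scale b f) = hom_scale (a * b) f.
Proof. by apply: homs_eq => V h m /=; rewrite scalerA rmorphM. Qed.
Fact hom_scale1 W : left_id 1 (@hom_scale W).
Proof. by move=> f; apply: homs_eq => V h m /=; rewrite rmorph1 scale1r. Qed.
Fact hom_scaleDr W : right_distributive (@hom_scale W) +%R.
Proof. by move=> a f g; apply: homs_eq => V h m /=; rewrite scalerDr. Qed.
Fact hom_scaleDl W (f : homs W) : {morph (@hom_scale W)^~ f : a b / a + b}.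
Proof. by move=> a b; apply: homs_eq => V h m /=; rewrite rmorphD scalerDl. Qed.
HB.instance Definition _ W := GRing.Zmodule_isLmodule.Build (OO X W) (homs W)
  (@hom_scaleA W) (@hom_scale1 W) (@hom_scaleDr W) (@hom_scaleDl W).

Program Definition hom_res U V (hVU : V <=o U) (f : homs U) : homs V :=
  @Homs V (fun W h m => f W (subset_trans h hVU) m) _ _.
Next Obligation. by move=> * /=; rewrite hom_lin. Qed.
Next Obligation. by move=> * /=; apply: hom_nat. Qed.
Fact hom_res_additive U V (h : V <=o U) : zmod_morphism (hom_res h).
Proof. by move=> f g; apply: homs_eq. Qed.
HB.instance Definition _ U V (h : V <=o U) :=
  GRing.isZmodMorphism.Build _ _ (hom_res h) (hom_res_additive h).
Fact hom_resZ U V (h : V <=o U) (a : OO X U) (f : homs U) :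
  hom_res h (a *: f) = resO h a *: hom_res h f.
Proof.
by apply: homs_eq => W g m /=; rewrite (resO_comp h g (subset_trans g h)).
Qed.
Fact hom_res_id U (h : U <=o U) (f : homs U) : hom_res h f = f.
Proof.
by apply: homs_eq => W g m /=; rewrite (Prop_irrelevance (subset_trans g h) g).
Qed.
Fact hom_res_comp U V W (hV : V <=o U) (hW : W <=o V) (h : W <=o U)
  (f : homs U) : hom_res hW (hom_res hV f) = hom_res h f.
Proof.
apply: homs_eq => T g m /=.
by rewrite (Prop_irrelevance (subset_trans (subset_trans g hW) hV)
  (subset_trans g h)).
Qed.
Definition Hom : pmod X :=
  @PMod k X homs (fun U V h => hom_res h) hom_resZ hom_res_id hom_res_comp.

Definition mor := homs (otop X).
Definition ap (f : mor) U : M U -> N U := f U (@sub_otop _ U).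

Definition is_iso (f : mor) : Prop := forall U, bijective (@ap f U).

End Hom.

Definition EndM M := Hom M M.
Definition dual M := Hom M Omod.

Program Definition hom_id M U : EndM M U := @Homs M M U (fun V h m => m) _ _.
Next Obligation. by []. Qed.
Next Obligation. by []. Qed.

(* [tensor M N] is only used for M locally free of finite rank, where the
   tensor product M (x) N is canonically Hom(M^dual, N): the section m (x) n
   is the map t |-> t(m) n, see [tens]. *)
Definition tensor M N := Hom (dual M) N.

Definition pair_dual M U V (h : V <=o U) (t : dual M V) (m : M U) : OO X V :=
  t V (@subo_refl _ V) (res M h m).

Program Definition tens M N U (m : M U) (n : N U) : tensor M N U :=
  @Homs (dual M) N U (fun V h t => pair_dual h t m *: res N h n) _ _.
Next Obligation.
move=> M N U m n V h a t t'.
rewrite /= /pair_dual /= resO_id scalerDl scalerA //.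
Qed.
Next Obligation.
move=> M N U m n V V' h h' h'' t.
rewrite /= resZ res_comp /pair_dual; congr (_ *: _).
transitivity (t V' h' (res M h' (res M h m))).
  exact: (hom_nat t (@subo_refl _ V) h' h' (res M h m)).
rewrite (res_comp h h' h'') /=; congr (t V' _ _); exact: Prop_irrelevance.
Qed.

Program Definition tensor_map M N N' (f : mor N N') :
    mor (tensor M N) (tensor M N') :=
  @Homs (tensor M N) (tensor M N') (otop X) (fun U h s =>
    @Homs (dual M) N' U (fun V h' t => ap f (s V h' t)) _ _) _ _.
Next Obligation. by move=> * /=; rewrite hom_lin /ap hom_lin. Qed.
Next Obligation.
move=> M N N' f U h s V V' h1 h2 h3 t.
by rewrite /= /ap (hom_nat f (sub_otop (U := V)) h2 (sub_otop (U := V'))) (hom_nat s h1 h2 h3).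
Qed.
Next Obligation.
move=> M N N' f V h a s s'; apply: homs_eq => W g t /=.
by rewrite /ap hom_lin.
Qed.
Next Obligation. by move=> * /=; apply: homs_eq. Qed.

End Modules.

Arguments Omod {k} X.
Arguments sub_otop {T} U.
Arguments subo_refl {T} U.

Section Schemes.
Variables (k : fieldType) (X : ringed_space k).
Implicit Types (U V W : opens X).

(* The germ of f at x is invertible. *)
Definition unit_at U (f : OO X U) (x : X) : Prop :=
  exists V (h : V <=o U), oset V x /\ exists g : OO X V, resO h f * g = 1.

Definition prime_ideal (A : comPzRingType) (P : set A) : Prop :=
  [/\ P 0, (forall a b, P a -> P b -> P (a + b)),
      (forall a b, P b -> P (a * b)), ~ P 1 &
      (forall a b, P (a * b) -> P a \/ P b)].

Definition nonunits U (x : X) : set (OO X U) :=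
  [set f | ~ unit_at f x].

(* U is isomorphic, as a ringed space, to Spec A for A = O(U): the points of U
   are the primes of A, the sets D(f) form a basis, and O(D(f)) = A_f. *)
Definition affine U : Prop :=
  [/\ (forall x, oset U x -> prime_ideal (@nonunits U x)),
      (forall P : set (OO X U), prime_ideal P ->
         exists! x, oset U x /\ @nonunits U x = P),
      (forall V x, V <=o U -> oset V x ->
         exists f : OO X U, unit_at f x /\
           forall y, oset U y -> unit_at f y -> oset V y) &
      (forall (f : OO X U) V (h : V <=o U),
         (forall y, oset V y <-> oset U y /\ unit_at f y) ->
         (forall g : OO X V, exists n (a : OO X U),
            resO h f ^+ n * g = resO h a) /\
         (forall a : OO X U, resO h a = 0 -> exists n, f ^+ n * a = 0))].

(* The k-algebra O(U) is generated by G. *)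
Definition generated_by U (G : set (OO X U)) : Prop :=
  forall S : set (OO X U),
    (forall c, S (cst U c)) ->
    (forall a b, S a -> S b -> S (a + b)) ->
    (forall a b, S a -> S b -> S (a * b)) ->
    G `<=` S -> forall f, S f.

Definition is_scheme : Prop :=
  is_sheaf (Omod X) /\
  forall x : X, exists U, oset U x /\ affine U.

Definition locally_finite_type : Prop :=
  forall x : X, exists U n (a : 'I_n -> OO X U),
    [/\ oset U x, affine U & generated_by (range a)].

Definition integral : Prop :=
  (exists x : X, True) /\
  forall U, (exists x, oset U x) ->
    (1 : OO X U) <> 0 /\
    forall f g : OO X U, f * g = 0 -> f = 0 \/ g = 0.

(* X is isomorphic to a closed subscheme of some P^n over k.  Morphisms
   X -> P^n are line bundles with generating sections s_0, ..., s_n, and such a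
   morphism is a closed immersion iff every X_{s_i} is affine with coordinate
   ring generated by the s_j / s_i (Hartshorne, II.7.1 and II.7.2). *)
Definition projective : Prop :=
  exists (N : pmod X) (n : nat) (s : 'I_n.+1 -> N (otop X))
         (V : 'I_n.+1 -> opens X),
  [/\ line_bundle N, (forall x, exists i, oset (V i) x) &
    forall i,
    [/\ (forall x, oset (V i) x <->
           exists W, oset W x /\ is_generator (res N (sub_otop W) (s i))),
        affine (V i) &
        generated_by [set g | exists j,
          res N (sub_otop (V i)) (s j) = g *: res N (sub_otop (V i)) (s i)]]].

Definition derivation U (M : lmodType (OO X U)) (D : OO X U -> M) : Prop :=
  [/\ (forall a b, D (a + b) = D a + D b),
      (forall a b, D (a * b) = a *: D b + b *: D a) &
      (forall c, D (cst U c) = 0)].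

(* The sheaf Omega^1 of X over k: over each affine open U it is the module of
   Kaehler differentials of O(U). *)
Record cotangent := Cotangent {
  Om :> pmod X;
  Om_sheaf : is_sheaf Om;
  dif : forall U, OO X U -> Om U;
  dif_der : forall U, derivation (@dif U);
  dif_res : forall U V (h : V <=o U) (f : OO X U),
    res Om h (dif f) = dif (resO h f);
  dif_univ : forall U, affine U ->
    forall (M : lmodType (OO X U)) (D : OO X U -> M), derivation D ->
    exists! u : {linear Om U -> M}, forall f, u (dif f) = D f }.

(* Smooth of relative dimension 1 over k (for k of characteristic 0). *)
Definition smooth_curve (Omega : cotangent) : Prop :=
  [/\ is_scheme, locally_finite_type & locally_free Omega 1].

Definition smooth_projective_curve (Omega : cotangent) : Prop :=
  [/\ smooth_curve Omega, integral & projective].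

End Schemes.

Arguments dif {k X} _ {U} _.

Section Morphisms.
Variables (k : fieldType) (Y X : ringed_space k).

Definition opre (f : Y -> X) (cf : continuous f) (U : opens X) : opens Y :=
  Opens (@open_comp _ _ f U (fun x _ => cf x) (oset_open U)).

Record morphism := Morphism {
  mfun :> Y -> X;
  mcont : continuous mfun;
  pull : forall U : opens X, {rmorphism OO X U -> OO Y (opre mcont U)};
  pull_cst : forall U c, pull U (cst U c) = cst (opre mcont U) c;
  pull_res : forall (U V : opens X) (h : V <=o U)
    (h' : opre mcont V <=o opre mcont U) (f : OO X U),
    resO h' (pull U f) = pull V (resO h f);
  pull_local : forall (U : opens X) (f : OO X U) (y : Y),
    oset U (mfun y) -> unit_at (pull U f) y -> unit_at f (mfun y) }.

Arguments mcont : clear implicits.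
Arguments pull : clear implicits.
Variable f : morphism.

Definition pre (U : opens X) : opens Y := opre (mcont f) U.

Lemma pre_sub (U V : opens X) : V <=o U -> pre V <=o pre U.
Proof. by move=> h y; apply: h. Qed.

Section PushForward.
Variable F : pmod Y.

Definition push_sec (U : opens X) : Type := F (pre U).
HB.instance Definition _ U := GRing.Zmodule.on (push_sec U).

Definition push_scale U (a : OO X U) (m : push_sec U) : push_sec U :=
  (pull f U a : OO Y (pre U)) *: (m : F (pre U)).
Fact push_scaleA U a b (m : push_sec U) :
  push_scale a (push_scale b m) = push_scale (a * b) m.
Proof. by rewrite /push_scale scalerA rmorphM. Qed.
Fact push_scale1 U : left_id 1 (@push_scale U).
Proof. by move=> m; rewrite /push_scale rmorph1 scale1r. Qed.
Fact push_scaleDr U : right_distributive (@push_scale U) +%R.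
Proof. by move=> a m n; rewrite /push_scale scalerDr. Qed.
Fact push_scaleDl U (m : push_sec U) :
  {morph (@push_scale U)^~ m : a b / a + b}.
Proof. by move=> a b; rewrite /push_scale rmorphD scalerDl. Qed.
HB.instance Definition _ U := GRing.Zmodule_isLmodule.Build (OO X U)
  (push_sec U) (@push_scaleA U) (@push_scale1 U) (@push_scaleDr U)
  (@push_scaleDl U).

Definition push_res U V (h : V <=o U) : push_sec U -> push_sec V :=
  res F (pre_sub h).
Fact push_res_additive U V (h : V <=o U) : zmod_morphism (push_res h).
Proof. by move=> m n; rewrite /push_res raddfB. Qed.
HB.instance Definition _ U V (h : V <=o U) :=
  GRing.isZmodMorphism.Build _ _ (push_res h) (push_res_additive h).
Fact push_resZ U V (h : V <=o U) (a : OO X U) (m : push_sec U) :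
  push_res h (a *: m) = resO h a *: push_res h m.
Proof.
rewrite /push_res; transitivity (resO (pre_sub h) (pull f U a) *: res F (pre_sub h) m).
  exact: resZ.
by rewrite (pull_res h).
Qed.
Fact push_res_id U (h : U <=o U) (m : push_sec U) : push_res h m = m.
Proof. exact: res_id. Qed.
Fact push_res_comp U V W (hV : V <=o U) (hW : W <=o V) (h : W <=o U)
  (m : push_sec U) : push_res hW (push_res hV m) = push_res h m.
Proof. exact: res_comp. Qed.

Definition push : pmod X :=
  @PMod k X push_sec (fun U V h => push_res h) push_resZ push_res_id
    push_res_comp.

End PushForward.
End Morphisms.

Arguments pull {k Y X} _ U.
Arguments pre {k Y X} f U.

Section Jets.
Variables (k : fieldType) (X : ringed_space k) (Om : cotangent X).
Variable F : pmod X.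

(* Atiyah's description of J^1(F): as a sheaf of k-vector spaces it is
   F (+) Omega (x) F, with O acting by  a . (e, w) = (a e, a w + da (x) e), so
   that O-linear sections e |-> (e, D e) of J^1(F) -> F are connections D. *)
Definition jet_sec (U : opens X) : Type := (F U * tensor Om F U)%type.
HB.instance Definition _ U := GRing.Zmodule.on (jet_sec U).

Definition jet_scale U (a : OO X U) (m : jet_sec U) : jet_sec U :=
  (a *: m.1, a *: m.2 + tens (dif Om a) m.1).

Lemma tensDl U (w w' : Om U) (e : F U) : tens (w + w') e = tens w e + tens w' e.
Proof.
apply: homs_eq => V h t /=; rewrite /pair_dual -scalerDl raddfD; congr (_ *: _).
by have := hom_lin t (subo_refl V) 1 (res Om h w) (res Om h w'); rewrite !scale1r.
Qed.
Lemma tensDr U (w : Om U) (e e' : F U) : tens w (e + e') = tens w e + tens w e'.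
Proof. by apply: homs_eq => V h t /=; rewrite raddfD scalerDr. Qed.
Lemma tensZl U (a : OO X U) (w : Om U) (e : F U) : tens (a *: w) e = a *: tens w e.
Proof.
apply: homs_eq => V h t /=; rewrite /pair_dual scalerA resZ; congr (_ *: _).
have := hom_lin t (subo_refl V) (resO h a) (res Om h w) 0.
have H0 : t V (subo_refl V) 0 = 0.
  have := hom_lin t (subo_refl V) 1 0 0; rewrite !scale1r addr0.
  by move/(congr1 (fun x => x - t V (subo_refl V) 0)); rewrite subrr addrK.
by rewrite H0 !addr0.
Qed.
Lemma tensZr U (a : OO X U) (w : Om U) (e : F U) : tens w (a *: e) = a *: tens w e.
Proof. by apply: homs_eq => V h t /=; rewrite resZ !scalerA mulrC. Qed.

Fact jet_scaleA U a b (m : jet_sec U) :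
  jet_scale a (jet_scale b m) = jet_scale (a * b) m.
Proof.
case: (dif_der Om U) => _ dM _.
rewrite /jet_scale /= scalerA; congr (_, _).
by rewrite dM tensDl !tensZl scalerDr scalerA tensZr addrA.
Qed.
Fact jet_scale1 U : left_id 1 (@jet_scale U).
Proof.
case: (dif_der Om U) => _ _ dc [e w].
rewrite /jet_scale /= !scale1r -(rmorph1 (cst U)) dc; congr (_, _).
have := tensDl (0 : Om U) 0 e; rewrite addr0.
by move/(congr1 (fun x => x - tens (0 : Om U) e)); rewrite subrr addrK => <-; rewrite addr0.
Qed.
Fact jet_scaleDr U : right_distributive (@jet_scale U) +%R.
Proof.
move=> a [e w] [e' w']; rewrite /jet_scale /=; congr (_, _); rewrite /= !scalerDr //.
by rewrite tensDr addrACA.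
Qed.
Fact jet_scaleDl U (m : jet_sec U) : {morph (@jet_scale U)^~ m : a b / a + b}.
Proof.
case: (dif_der Om U) => dD _ _ a b; rewrite /jet_scale /=; congr (_, _); rewrite /= !scalerDl //.
by rewrite dD tensDl addrACA.
Qed.
HB.instance Definition _ U := GRing.Zmodule_isLmodule.Build (OO X U)
  (jet_sec U) (@jet_scaleA U) (@jet_scale1 U) (@jet_scaleDr U) (@jet_scaleDl U).

Definition jet_res U V (h : V <=o U) (m : jet_sec U) : jet_sec V :=
  (res F h m.1, res (tensor Om F) h m.2).
Fact jet_res_additive U V (h : V <=o U) : zmod_morphism (jet_res h).
Proof. by move=> m n; rewrite /jet_res !raddfB. Qed.
HB.instance Definition _ U V (h : V <=o U) :=
  GRing.isZmodMorphism.Build _ _ (jet_res h) (jet_res_additive h).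
Lemma res_tens U V (h : V <=o U) (w : Om U) (e : F U) :
  res (tensor Om F) h (tens w e) = tens (res Om h w) (res F h e).
Proof.
apply: homs_eq => W h' t /=; rewrite /pair_dual.
by rewrite (res_comp h h' (subset_trans h' h)) (res_comp h h' (subset_trans h' h)).
Qed.
Fact jet_resZ U V (h : V <=o U) (a : OO X U) (m : jet_sec U) :
  jet_res h (a *: m) = resO h a *: jet_res h m.
Proof.
rewrite /jet_res /= /jet_scale /=; congr (_, _); first exact: resZ.
by rewrite (raddfD (res (tensor Om F) h)) resZ res_tens dif_res.
Qed.
Fact jet_res_id U (h : U <=o U) (m : jet_sec U) : jet_res h m = m.
Proof. by case: m => e w; rewrite /jet_res !res_id. Qed.
Fact jet_res_comp U V W (hV : V <=o U) (hW : W <=o V) (h : W <=o U)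
  (m : jet_sec U) : jet_res hW (jet_res hV m) = jet_res h m.
Proof. by rewrite /jet_res !(res_comp hV hW h). Qed.

Definition jet : pmod X :=
  @PMod k X jet_sec (fun U V h => jet_res h) jet_resZ jet_res_id jet_res_comp.

End Jets.
Section Cech.
Variables (k : fieldType) (X : ringed_space k).

(* Cech 1-cocycles of F|_W.  A cover of W is indexed by the points of X, with
   x in cov x when x is in W; such covers are cofinal among all open covers. *)
Record cocycle (W : opens X) (F : pmod X) := Cocycle {
  cov : X -> opens X;
  cov_sub : forall x, cov x <=o W;
  cov_in : forall x, oset W x -> oset (cov x) x;
  coc : forall x y, F (ocap (cov x) (cov y));
  coc_law : forall x y z V (hxy : V <=o ocap (cov x) (cov y))
    (hyz : V <=o ocap (cov y) (cov z)) (hxz : V <=o ocap (cov x) (cov z)),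
    res F hxy (coc x y) + res F hyz (coc y z) = res F hxz (coc x z) }.

(* The cocycles become cohomologous on a common refinement. *)
Definition cohomologous W F (c c' : cocycle W F) : Prop :=
  exists (w : X -> opens X) (h : forall x, w x <=o cov c x)
         (h' : forall x, w x <=o cov c' x) (b : forall x, F (w x)),
    (forall x, oset W x -> oset (w x) x) /\
    forall x y V (hx : V <=o w x) (hy : V <=o w y)
      (hc : V <=o ocap (cov c x) (cov c y))
      (hc' : V <=o ocap (cov c' x) (cov c' y)),
      res F hc (coc c x y) - res F hc' (coc c' x y)
        = res F hy (b y) - res F hx (b x).

HB.instance Definition _ W F := gen_eqMixin (cocycle W F).
HB.instance Definition _ W F := gen_choiceMixin (cocycle W F).

Definition cohomb W F (c c' : cocycle W F) : bool := `[< cohomologous c c' >].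

Fact cohomb_refl W F : reflexive (@cohomb W F).
Proof.
move=> c; apply/asboolP.
exists (cov c), (fun x => subo_refl _), (fun x => subo_refl _), (fun x => 0).
split=> [|x y V hx hy hc hc']; first exact: cov_in.
by rewrite !raddf0 addr0 (Prop_irrelevance hc hc') subrr.
Qed.

Fact cohomb_imp W F (c c' : cocycle W F) : cohomb c c' -> cohomb c' c.
Proof.
move=> /asboolP[w [h [h' [b [hw hb]]]]]; apply/asboolP.
exists w, h', h, (fun x => - b x); split=> // x y V hx hy hc hc'.
by rewrite !raddfN -opprB (hb x y V hx hy) opprB opprK addrC.
Qed.

Fact cohomb_sym W F : symmetric (@cohomb W F).
Proof. by move=> c c'; apply/idP/idP; apply: cohomb_imp. Qed.

Fact cohomb_trans W F : transitive (@cohomb W F).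
Proof.
move=> c2 c1 c3 /asboolP[w [h1 [h2 [b [hw hb]]]]] /asboolP[w' [h2' [h3 [b' [hw' hb']]]]].
apply/asboolP; exists (fun x => ocap (w x) (w' x)).
have s1 x : ocap (w x) (w' x) <=o w x by move=> y [].
have s2 x : ocap (w x) (w' x) <=o w' x by move=> y [].
exists (fun x => subset_trans (s1 x) (h1 x)), (fun x => subset_trans (s2 x) (h3 x)).
exists (fun x => res F (s1 x) (b x) + res F (s2 x) (b' x)).
split=> [x Wx|x y V hx hy hc hc']; first by split; [apply: hw|apply: hw'].
pose hx1 := subset_trans hx (s1 x); pose hx2 := subset_trans hx (s2 x).
pose hy1 := subset_trans hy (s1 y); pose hy2 := subset_trans hy (s2 y).
have hc2 : V <=o ocap (cov c2 x) (cov c2 y).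
  by move=> z Vz; split; [apply: (h2 x); apply: hx1|apply: (h2 y); apply: hy1].
have E1 := hb x y V hx1 hy1 hc hc2.
have E2 := hb' x y V hx2 hy2 hc2 hc'.
rewrite !raddfD (res_comp (s1 x) hx hx1) (res_comp (s2 x) hx hx2).
rewrite (res_comp (s1 y) hy hy1) (res_comp (s2 y) hy hy2) addrACA -E1 -E2.
by rewrite addrA subrK.
Qed.

Canonical cohom_equiv W F :=
  EquivRel (@cohomb W F) (@cohomb_refl W F) (@cohomb_sym W F)
    (@cohomb_trans W F).

Definition H1 (W : opens X) (F : pmod X) : Type := {eq_quot (cohom_equiv W F)}.

Definition H1_class W F (c : cocycle W F) : H1 W F :=
  \pi_({eq_quot (cohom_equiv W F)}) c.
Definition H1_repr W F (a : H1 W F) : cocycle W F :=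
  repr (a : {eq_quot (cohom_equiv W F)}).

Program Definition coc0 W F : cocycle W F :=
  @Cocycle W F (fun=> W) _ _ (fun _ _ => 0) _.
Next Obligation. by move=> W F x y. Qed.
Next Obligation. by move=> W F x. Qed.
Next Obligation. by move=> *; rewrite !raddf0 addr0. Qed.

Program Definition coc_map W F G (f : mor F G) (c : cocycle W F) :
    cocycle W G :=
  @Cocycle W G (cov c) (@cov_sub _ _ c) (@cov_in _ _ c)
    (fun x y => ap f (coc c x y)) _.
Next Obligation.
move=> W F G f c x y z V hxy hyz hxz; rewrite /ap.
rewrite !(hom_nat f _ _ (sub_otop V)) -(coc_law hxy hyz hxz).
by have := hom_lin f (sub_otop V) 1 (res F hxy (coc c x y)) (res F hyz (coc c y z));
  rewrite !scale1r.
Qed.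

Program Definition coc_res W W' (hW : W' <=o W) F (c : cocycle W F) :
    cocycle W' F :=
  @Cocycle W' F (fun x => ocap (cov c x) W') _ _
    (fun x y => res F _ (coc c x y)) _.
Next Obligation. by move=> W W' hW F c x y []. Qed.
Next Obligation. by move=> W W' hW F c x W'x; split=> //; apply/cov_in/hW. Qed.
Next Obligation. by move=> W W' hW F c x y z [[? _] [? _]]. Qed.
Next Obligation.
move=> W W' hW F c x y z V hxy hyz hxz.
have gxy : V <=o ocap (cov c x) (cov c y) by move=> u /hxy[[? _] [? _]].
have gyz : V <=o ocap (cov c y) (cov c z) by move=> u /hyz[[? _] [? _]].
have gxz : V <=o ocap (cov c x) (cov c z) by move=> u /hxz[[? _] [? _]].
by rewrite (res_comp _ hxy gxy) (res_comp _ hyz gyz) (res_comp _ hxz gxz); apply: coc_law.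
Qed.

Lemma H1_classP W F (c c' : cocycle W F) :
  H1_class c = H1_class c' <-> cohomologous c c'.
Proof. by split=> [/eqmodP/asboolP|?] //; apply/eqmodP/asboolP. Qed.

Lemma apB (F G : pmod X) (f : mor F G) (U : opens X) (a b : F U) :
  ap f (a - b) = ap f a - ap f b.
Proof.
by have := hom_lin f (sub_otop U) (-1) b a; rewrite !scaleN1r ![- _ + _]addrC.
Qed.

Lemma ap_res (F G : pmod X) (f : mor F G) (U V : opens X)
  (h : V <=o U) (a : F U) :
  res G h (ap f a) = ap f (res F h a).
Proof. exact: hom_nat. Qed.

Lemma coc_map_cohom W F G (f : mor F G) (c c' : cocycle W F) :
  cohomologous c c' -> cohomologous (coc_map f c) (coc_map f c').
Proof.
case=> w [h [h' [b [hw hb]]]]; exists w, h, h', (fun x => ap f (b x)).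
split=> // x y V hx hy hc hc' /=.
by rewrite !ap_res -!apB; congr (ap f _); apply: hb.
Qed.

Lemma coc_res_cohom W W' (hW : W' <=o W) F (c c' : cocycle W F) :
  cohomologous c c' -> cohomologous (coc_res hW c) (coc_res hW c').
Proof.
case=> w [h [h' [b [hw hb]]]].
have s x : ocap (w x) W' <=o w x by move=> ? [].
have g x : ocap (w x) W' <=o ocap (cov c x) W' by move=> ? [/h ? ?].
have g' x : ocap (w x) W' <=o ocap (cov c' x) W' by move=> ? [/h' ? ?].
exists (fun x => ocap (w x) W'), g, g', (fun x => res F (s x) (b x)).
split=> [x W'x|x y V hx hy hc hc' /=]; first by split=> //; apply/hw/hW.
have Vc : V <=o ocap (cov c x) (cov c y) by move=> ? /hc[[? _] [? _]].
have Vc' : V <=o ocap (cov c' x) (cov c' y) by move=> ? /hc'[[? _] [? _]].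
rewrite (res_comp _ hc Vc) (res_comp _ hc' Vc').
rewrite (res_comp _ hx (subset_trans hx (s x))) (res_comp _ hy (subset_trans hy (s y))).
exact: hb.
Qed.

Definition H1_zero W F : H1 W F := H1_class (coc0 W F).

(* Independent of the representative by [coc_map_cohom] and [coc_res_cohom]. *)
Definition H1_map W F G (f : mor F G) (a : H1 W F) : H1 W G :=
  H1_class (coc_map f (H1_repr a)).
Definition H1_res W W' (h : W' <=o W) F (a : H1 W F) : H1 W' F :=
  H1_class (coc_res h (H1_repr a)).

End Cech.

Section CechPull.
Variables (k : fieldType) (Y X : ringed_space k) (f : morphism Y X).

Program Definition coc_pull (W : opens X) (F : pmod Y)
    (c : cocycle W (push f F)) : cocycle (pre f W) F :=
  @Cocycle k Y (pre f W) F (fun y => pre f (cov c (f y))) _ _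
    (fun y z => res F _ (coc c (f y) (f z) : F (pre f _))) _.
Next Obligation. by move=> W F c y z; apply: cov_sub. Qed.
Next Obligation. by move=> W F c y Wy; exact: (cov_in c Wy). Qed.
Next Obligation. by move=> W F c y z u []. Qed.
Next Obligation.
move=> W F c x y z V hxy hyz hxz.
set A := cov c (f x); set B := cov c (f y); set C := cov c (f z).
pose T := ocap A (ocap B C).
have tAB : T <=o ocap A B by move=> u [? []].
have tBC : T <=o ocap B C by move=> u [? []].
have tAC : T <=o ocap A C by move=> u [? []].
have VT : V <=o pre f T.
  by move=> u Vu; have [? ?] := hxy u Vu; have [? ?] := hyz u Vu.
have VAB : V <=o pre f (ocap A B) := subset_trans VT (pre_sub tAB).
have VBC : V <=o pre f (ocap B C) := subset_trans VT (pre_sub tBC).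
have VAC : V <=o pre f (ocap A C) := subset_trans VT (pre_sub tAC).
have E : push_res tAB (coc c (f x) (f y)) + push_res tBC (coc c (f y) (f z))
          = push_res tAC (coc c (f x) (f z)) := coc_law tAB tBC tAC.
rewrite (res_comp _ hxy VAB) (res_comp _ hyz VBC) (res_comp _ hxz VAC).
have := congr1 (res F VT) E; rewrite raddfD /push_res.
by rewrite (res_comp _ VT VAB) (res_comp _ VT VBC) (res_comp _ VT VAC).
Qed.

Lemma coc_pull_cohom (W : opens X) (F : pmod Y)
    (c c' : cocycle W (push f F)) :
  cohomologous c c' -> cohomologous (coc_pull c) (coc_pull c').
Proof.
case=> w [h [h' [b [hw hb]]]].
exists (fun y => pre f (w (f y))), (fun y => pre_sub (h (f y))),
  (fun y => pre_sub (h' (f y))), (fun y => b (f y)).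
split=> [y Wy|y z V hy hz hc hc' /=]; first exact: (hw (f y) Wy).
set A := w (f y); set B := w (f z).
have AB1 : ocap A B <=o A by move=> ? [].
have AB2 : ocap A B <=o B by move=> ? [].
have ABc : ocap A B <=o ocap (cov c (f y)) (cov c (f z)).
  by move=> u [Au Bu]; split; [apply: (h (f y))|apply: (h (f z))].
have ABc' : ocap A B <=o ocap (cov c' (f y)) (cov c' (f z)).
  by move=> u [Au Bu]; split; [apply: (h' (f y))|apply: (h' (f z))].
have VAB : V <=o pre f (ocap A B).
  by move=> u Vu; have := hy u Vu; have := hz u Vu.
have := congr1 (res F VAB) (hb (f y) (f z) _ AB1 AB2 ABc ABc').
rewrite !raddfB /= /push_res.
rewrite (res_comp _ VAB (subset_trans VAB (pre_sub ABc))).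
rewrite (res_comp _ VAB (subset_trans VAB (pre_sub ABc'))).
rewrite (res_comp _ VAB hz) (res_comp _ VAB hy) => <-.
rewrite (res_comp _ hc (subset_trans VAB (pre_sub ABc))).
by rewrite (res_comp _ hc' (subset_trans VAB (pre_sub ABc'))).
Qed.

(* H^1(W, f_* F) -> H^1(f^-1 W, F); an isomorphism when f is finite and F is
   quasi-coherent. *)
Definition H1_pull (W : opens X) (F : pmod Y) (a : H1 W (push f F)) :
    H1 (pre f W) F := H1_class (coc_pull (H1_repr a)).

End CechPull.

Section Atiyah.
Variables (k : fieldType) (X : ringed_space k) (Om : cotangent X).

(* [c] represents the image of id_F under the connecting map of
     0 -> Hom(F, Omega (x) F) -> Hom(F, J^1(F)) -> Hom(F, F) -> 0   over W:
   sg x lifts id_F over cov x, and sg y - sg x takes values in Omega (x) F, where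
   Hom(F, Omega (x) F) is identified with Omega (x) End(F). *)
Definition is_atiyah_cocycle W (F : pmod X)
    (c : cocycle W (tensor Om (EndM F))) : Prop :=
  exists sg : forall x, homs F (jet Om F) (cov c x),
    (forall x V (h : V <=o cov c x) (e : F V),
       (sg x V h e : jet_sec Om F V).1 = e) /\
    (forall x y V (h : V <=o ocap (cov c x) (cov c y))
       (hx : V <=o cov c x) (hy : V <=o cov c y) (t : dual Om V) (e : F V),
       coc c x y V h t V (subo_refl V) e
       = ((sg y V hy e : jet_sec Om F V).2 - (sg x V hx e : jet_sec Om F V).2)
           V (subo_refl V) t).

(* At(F|_W) for F a vector bundle: local lifts exist and the class does not
   depend on them, so the set below is a singleton. *)
Definition atiyah W (F : pmod X) : H1 W (tensor Om (EndM F)) :=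
  xget (H1_zero W (tensor Om (EndM F)))
    [set a | exists c, is_atiyah_cocycle c /\ a = H1_class c].

Program Definition scalar_end (F : pmod X) : mor Om (tensor Om (EndM F)) :=
  @Homs k X Om (tensor Om (EndM F)) (otop X)
    (fun U _ w => tens w (hom_id F U)) _ _.
Next Obligation. by move=> F V h a w w' /=; rewrite tensDl tensZl. Qed.
Next Obligation. by move=> F V V' ? h' ? w /=; rewrite -[hom_res _ _]/(res (tensor Om (EndM F)) h' _) res_tens; congr tens; apply: homs_eq. Qed.

(* At(L|_W) in H^1(W, Omega) for a line bundle L, where w |-> w (x) id
   is an isomorphism from Omega to Omega (x) End(L). *)
Definition atiyah_line W (L : pmod X) : H1 W Om :=
  xget (H1_zero W Om) [set a | H1_map (scalar_end L) a = atiyah W L].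

End Atiyah.

Definition nzring (A : comPzRingType) (h : (1 : A) != 0) : comNzRingType :=
  HB.pack (A : Type) (GRing.ComPzRing.class A)
    (GRing.PzSemiRing_isNonZero.Build A h).

Definition discriminant (A : nzRingType) (p : {poly A}) : A :=
  resultant p p^`().

Section Higgs.
Variables (k : fieldType) (X : ringed_space k) (Om : cotangent X).
Variables (E : pmod X) (theta : mor E (tensor Om E)).

(* The contraction of theta(e) with t. *)
Definition contract U (t : dual Om U) (e : E U) : E U :=
  ap theta e U (subo_refl U) t.

(* A nonempty open set U with a frame of E and a generator ch_coord of the dual
   of Omega; ch_coord is a linear coordinate on Tot(Omega) over U, and
   ch_mat is the matrix of theta with respect to it. *)
Record chart (r : nat) := Chart {
  ch_open : opens X;
  ch_nz : (1 : OO X ch_open) != 0;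
  ch_frame : 'I_r -> E ch_open;
  ch_frameP : is_frame ch_frame;
  ch_coord : dual Om ch_open;
  ch_coordP : is_generator ch_coord;
  ch_mat : 'M[nzring ch_nz]_r;
  ch_matP : forall j, contract ch_coord (ch_frame j)
    = \sum_(i < r) (ch_mat i j : OO X ch_open) *: ch_frame i }.

Definition ch_poly r (c : chart r) : {poly nzring (ch_nz c)} :=
  char_poly (ch_mat c).

Definition ch_disc r (c : chart r) : OO X (ch_open c) :=
  discriminant (ch_poly c).

Definition regular_semisimple (r : nat) : Prop :=
  exists c : chart r, ch_disc c <> 0.

(* The complement of the discriminant divisor. *)
Definition etale_set (r : nat) : set X :=
  [set x | exists c : chart r, oset (ch_open c) x /\ unit_at (ch_disc c) x].

Fact etale_set_open r : open (etale_set r).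
Proof.
rewrite openE => x [c [Ux [V [h [Vx [g hg]]]]]].
rewrite /interior nbhsE; exists (oset V); first by split=> //; exact: oset_open.
move=> y Vy; exists c; split; first exact: (h y Vy).
by exists V, h; split=> //; exists g.
Qed.

Definition etale_locus (r : nat) : opens X := Opens (etale_set_open r).

Section Spectral.
Variables (Y : ringed_space k) (p : morphism Y X).
Variable lam : mor (dual Om) (push p (Omod Y)).

(* The value on p^-1(U) of the linear coordinate t on Tot(Omega). *)
Definition taut U (t : dual Om U) : OO Y (pre p U) := ap lam t.

Definition ch_eval r (c : chart r) (q : {poly nzring (ch_nz c)}) :
    OO Y (pre p (ch_open c)) :=
  \sum_(i < size q)
    pull p (ch_open c) (q`_i : OO X (ch_open c)) * taut (ch_coord c) ^+ i.

(* A map Y -> Tot(Omega) = Spec Sym(Omega^dual) over X is an O_X-linear map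
   lam : Omega^dual -> p_* O_Y.  It identifies Y with the zero scheme of the
   characteristic polynomial of theta iff, over every affine chart, p^-1(U) is
   affine with ring O(U)[T] / (ch_poly), T being sent to [taut]. *)
Definition is_spectral_curve (r : nat) : Prop :=
  forall c : chart r, affine (ch_open c) ->
  [/\ affine (pre p (ch_open c)),
      (forall g, exists q : {poly nzring (ch_nz c)}, ch_eval q = g) &
      (forall q : {poly nzring (ch_nz c)},
         ch_eval q = 0 <-> exists q', q = q' * ch_poly c)].

(* phi : E -> p_* L is an isomorphism under which theta is multiplication by the
   tautological section. *)
Definition is_spectral_bundle (L : pmod Y) (phi : mor E (push p L)) : Prop :=
  is_iso phi /\
  forall U (t : dual Om U) (e : E U),
    (ap phi (contract t e) : L (pre p U)) = taut t *: (ap phi e : L (pre p U)).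

(* m is the action of p_* O_Y on E, transported from p_* L along phi. *)
Definition is_multiplication (L : pmod Y) (phi : mor E (push p L))
    (m : mor (push p (Omod Y)) (EndM E)) : Prop :=
  forall U V (h : V <=o U) (g : OO Y (pre p U)) (e : E V),
    (ap phi (ap m (g : push p (Omod Y) U) V h e) : L (pre p V))
    = resO (pre_sub h) g *: (ap phi e : L (pre p V)).

End Spectral.
End Higgs.

Section SpectralAtiyah.
Variables (k : fieldType) (Y X : ringed_space k) (p : morphism Y X).
Variables (OmX : cotangent X) (OmY : cotangent Y).

Definition is_form_pullback (dp : mor OmX (push p OmY)) : Prop :=
  forall U (f : OO X U),
    (ap dp (dif OmX f) : OmY (pre p U)) = dif OmY (pull p U f).

(* Omega_X (x) p_* O_Y -> p_* Omega_Y,  w (x) g |-> g . p^*(w): the composite of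
   the projection formula with p^* Omega_X -> Omega_Y. *)
Definition is_form_projection (dp : mor OmX (push p OmY))
    (psi : mor (tensor OmX (push p (Omod Y))) (push p OmY)) : Prop :=
  forall U (w : OmX U) (g : OO Y (pre p U)),
    (ap psi (tens w (g : push p (Omod Y) U)) : OmY (pre p U))
    = g *: (ap dp w : OmY (pre p U)).

(* H^1(W, Omega_X (x) p_* O_Y) -> H^1(p^-1 W, Omega_Y); an isomorphism if p is
   finite etale over W. *)
Definition H1_spec (W : opens X)
    (psi : mor (tensor OmX (push p (Omod Y))) (push p OmY))
    (a : H1 W (tensor OmX (push p (Omod Y)))) : H1 (pre p W) OmY :=
  H1_pull (H1_map psi a).

(* The class corresponding to At(L|_{p^-1 W}) under the isomorphism [H1_spec];
   the default value of [xget] is never used when p is finite etale over W. *)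
Definition beta_spec (W : opens X)
    (psi : mor (tensor OmX (push p (Omod Y))) (push p OmY)) (L : pmod Y) :
    H1 W (tensor OmX (push p (Omod Y))) :=
  xget (H1_zero W (tensor OmX (push p (Omod Y))))
    [set a | H1_spec psi a = atiyah_line OmY (pre p W) L].

End SpectralAtiyah.

(* Main.v *)
From HB Require Import structures.
From mathcomp Require Import all_boot all_order all_algebra.
From mathcomp Require Import complex ring.
From mathcomp Require Import boolp classical_sets reals topology.
Require Import Defs.

(* The Atiyah class is the class of the differences of local connections.  Near a
   point of X0 choose an affine chart U, with a generator w of OmX, on which the
   discriminant is invertible.  Then p^-1 U is affine, O(p^-1 U) = O(U)[T]/(chi)
   with chi'(T) a unit, and dp w generates OmY over p^-1 U.  As p^-1 U is affine,
   L has a connection nabla_U over all of p^-1 U.  The differences of the nabla_U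
   form a cocycle of p_* OmY = OmX (x) p_* O_Y on X0 that represents beta_spec.
   Transported along phi and dp, nabla_U becomes a connection of E over U, and the
   differences of these are the images of the same cocycle under id (x) m. *)

Set Implicit Arguments.
Unset Strict Implicit.
Unset Printing Implicit Defensive.
Import GRing.Theory.
Local Open Scope classical_set_scope.
Local Open Scope ring_scope.

(** * Morphisms and gluing *)

Section HomLemmas.
Variables (k : fieldType) (X : ringed_space k).
Implicit Types (U V W : opens X) (M N : pmod X).

(** Both [atiyah_line] and [beta_spec] are defined by [xget], so a value has to be exhibited and
    then shown to be the only one. An explicit cocycle provides the value. Uniqueness is the
    injectivity of three maps on H^1: the one induced by w |-> w (x) id from Omega to Omega (x)
    End(L), as L has rank one; the one induced by [psi], an isomorphism of sheaves over the etale
    locus; and [H1_pull]. A cocycle on Y comes visibly from X when its cover consists of preimages.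
    Frames of L live on small opens of Y that need not be preimages; this is the reason for a
    connection over all of p^-1 U, which rests on the vanishing of Cech cocycles on affine opens.
    The tensor product is encoded as Hom(M^dual, N), so its sections are computed by evaluating them
    at the coordinate dual to a generator of M. Hence the constant presence of local generators w
    and dp w. *)

Lemma res_irr M U V (h h' : V <=o U) (m : M U) : res M h m = res M h' m.
Proof. by rewrite (Prop_irrelevance h h'). Qed.

Lemma homs_irr M N W (f : homs M N W) V (h h' : V <=o W) (m : M V) :
  f V h m = f V h' m.
Proof. by rewrite (Prop_irrelevance h h'). Qed.

Lemma homs0 M N W (f : homs M N W) V (h : V <=o W) : f V h 0 = 0.
Proof.
have := hom_lin f h 1 0 0; rewrite !scale1r addr0.
by move/(congr1 (fun x => x - f V h 0)); rewrite subrr addrK.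
Qed.

Lemma homsD M N W (f : homs M N W) V (h : V <=o W) (m n : M V) :
  f V h (m + n) = f V h m + f V h n.
Proof. by have := hom_lin f h 1 m n; rewrite !scale1r. Qed.

Lemma homsZ M N W (f : homs M N W) V (h : V <=o W) a (m : M V) :
  f V h (a *: m) = a *: f V h m.
Proof. by have := hom_lin f h a m 0; rewrite homs0 !addr0. Qed.

Lemma apD M N (f : mor M N) U (a b : M U) : ap f (a + b) = ap f a + ap f b.
Proof. exact: homsD. Qed.

Lemma apZ M N (f : mor M N) U a (m : M U) : ap f (a *: m) = a *: ap f m.
Proof. exact: homsZ. Qed.

Lemma tensE M N U (w : M U) (n : N U) V (h : V <=o U) (t : dual M V) :
  tens w n V h t = (t V (subo_refl V) (res M h w) : OO X V) *: res N h n.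
Proof. by []. Qed.

Lemma tens0 M N U (w : M U) : tens w (0 : N U) = 0.
Proof. by apply: homs_eq => V h t; rewrite tensE raddf0 scaler0. Qed.

End HomLemmas.

Section Sheaves.
Variables (k : fieldType) (X : ringed_space k).
Implicit Types (U V W : opens X) (M N : pmod X).

Lemma sheaf_sep M U (s t : M U) : is_sheaf M ->
  (forall x, oset U x -> exists V (h : V <=o U),
     oset V x /\ res M h s = res M h t) -> s = t.
Proof.
move=> shM loc.
pose I := {V : opens X & {h : V <=o U | res M h s = res M h t}}.
pose v (i : I) := projT1 i.
have hv (i : I) : v i <=o U := sval (projT2 i).
have cover x : oset U x -> exists i : I, oset (v i) x.
  by move=> /loc[V [h [Vx e]]]; exists (existT _ V (exist _ h e)).
have [|z [_ zu]] := shM U I v hv (fun i => res M (hv i) s) cover.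
  move=> i j W hi hj.
  by rewrite (res_comp (hv i) hi (subset_trans hi (hv i)))
     (res_comp (hv j) hj (subset_trans hi (hv i))).
rewrite -(zu s) // -(zu t) // => i.
by case: i (hv i) => V [h e] hi; rewrite !(res_irr hi h).
Qed.

Lemma sheaf_empty M U (s t : M U) : is_sheaf M ->
  (forall x, ~ oset U x) -> s = t.
Proof. by move=> shM U0; apply: sheaf_sep => // x /U0. Qed.

(** The cover is indexed by all pairs of an open and a section satisfying [Q], so no local sections
    have to be chosen. In the applications [Q] determines the section, which gives the agreement on
    overlaps. *)
Lemma sheaf_glue M U (Q : forall V, V <=o U -> M V -> Prop) : is_sheaf M ->
  (forall x, oset U x -> exists V (h : V <=o U) (s : M V),
     oset V x /\ Q V h s) ->
  (forall V V' (h : V <=o U) (h' : V' <=o U) s s' W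
     (g : W <=o V) (g' : W <=o V'), Q V h s -> Q V' h' s' ->
     res M g s = res M g' s') ->
  exists t : M U, forall V (h : V <=o U) s, Q V h s -> res M h t = s.
Proof.
move=> shM loc agr.
pose I := {V : opens X & {s : M V | exists h, Q V h s}}.
pose v (i : I) := projT1 i.
have hv (i : I) : v i <=o U by case: i => V [s []].
have [||t [tv _]] := shM U I v hv (fun i => sval (projT2 i)).
- move=> x /loc[V [h [s [Vx q]]]].
  by exists (existT _ V (exist _ s (ex_intro _ h q))).
- move=> [V [s [h q]]] [V' [s' [h' q']]] W g g'; exact: agr q q'.
exists t => V h s q.
have := tv (existT _ V (exist _ s (ex_intro _ h q))) => /= <-.
exact: res_irr.
Qed.

(** The value of the glued morphism on m is glued in [N] from the values of the s_i on restrictions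
    of m, so only the target has to be a sheaf. Tensor products, being [Hom]s, are thereby sheaves
    without sheafification. *)
Lemma Hom_sheaf M N : is_sheaf N -> is_sheaf (Hom M N).
Proof.
move=> shN U I v hv s cover agr.
have ex V (hVU : V <=o U) (m : M V) : exists n : N V,
    forall i W (hW : W <=o V) (hi : W <=o v i),
      res N hW n = s i W hi (res M hW m).
  pose Q W (hW : W <=o V) (n : N W) :=
    exists i (hi : W <=o v i), n = s i W hi (res M hW m).
  have [||n nP] := @sheaf_glue N V Q shN.
  - move=> x Vx; have [i vix] := cover x (hVU x Vx).
    have hV : ocap V (v i) <=o V by move=> ? [].
    have hi : ocap V (v i) <=o v i by move=> ? [].
    by exists (ocap V (v i)), hV, (s i _ hi (res M hV m)); split=> //; exists i, hi.
  - move=> V1 V2 h1 h2 n1 n2 W g1 g2 [i [hi ->]] [j [hj ->]].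
    rewrite (hom_nat (s i) hi g1 (subset_trans g1 hi)).
    rewrite (hom_nat (s j) hj g2 (subset_trans g2 hj)).
    rewrite (res_comp h1 g1 (subset_trans g1 h1)).
    rewrite (res_comp h2 g2 (subset_trans g1 h1)).
    have := agr i j W (subset_trans g1 hi) (subset_trans g2 hj).
    move/(congr1 (fun f : homs M N W => f W (subo_refl W) (res M (subset_trans g1 h1) m))).
    rewrite /= (homs_irr (s i) _ (subset_trans g1 hi)) => ->.
    exact: homs_irr.
  by exists n => i W hW hi; apply: nP; exists i, hi.
pose t V h m := sval (cid (ex V h m)).
have tP V h (m : M V) i W (hW : W <=o V) (hi : W <=o v i) :
  res N hW (t V h m) = s i W hi (res M hW m).
  exact: (svalP (cid (ex V h m))).
have sub1 V i : ocap V (v i) <=o V by move=> ? [].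
have sub2 V i : ocap V (v i) <=o v i by move=> ? [].
have tU V (h : V <=o U) (m : M V) (n : N V) : (forall i,
    res N (sub1 V i) n = s i _ (sub2 V i) (res M (sub1 V i) m)) -> n = t V h m.
  move=> nP; apply: sheaf_sep => // x Vx; have [i vix] := cover x (h x Vx).
  by exists (ocap V (v i)), (sub1 V i); split=> //; rewrite nP (tP _ _ _ i _ _ (sub2 V i)).
have tl V (h : V <=o U) a (m n : M V) : t V h (a *: m + n) = a *: t V h m + t V h n.
  apply/esym/tU => i; rewrite !raddfD /= !resZ !(tP _ _ _ i _ _ (sub2 V i)).
  by rewrite hom_lin.
have tn V V' (h : V <=o U) (h' : V' <=o V) (h'' : V' <=o U) (m : M V) :
    res N h' (t V h m) = t V' h'' (res M h' m).
  apply: tU => i; rewrite (res_comp h' _ (subset_trans (sub1 V' i) h')).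
  rewrite (res_comp h' _ (subset_trans (sub1 V' i) h')).
  exact: tP.
exists (Homs tl tn); split=> [i|f fP].
  apply: homs_eq => V h m /=.
  have := tP V (subset_trans h (hv i)) m i V (subo_refl V) h.
  by rewrite !res_id.
apply: homs_eq => V h m /=; apply/esym/tU => i.
rewrite (hom_nat f h _ (subset_trans (sub2 V i) (hv i))) -(fP i) /=.
exact: homs_irr.
Qed.

(** Only the scalar action on jets is twisted; restriction is componentwise, so the two components
    glue separately. *)
Lemma jet_sheaf (Om : cotangent X) F : is_sheaf F -> is_sheaf (jet Om F).
Proof.
move=> shF U I v hv s cover agr.
have [|t1 [t1P t1U]] := shF U I v hv (fun i => (s i).1) cover.
  by move=> i j W hi hj; have E : jet_res hi (s i) = jet_res hj (s j) := agr i j W hi hj; case: E.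
have [|t2 [t2P t2U]] := Hom_sheaf shF (M := dual Om) hv (s := fun i => (s i).2) cover.
  move=> i j W hi hj; have E : jet_res hi (s i) = jet_res hj (s j) := agr i j W hi hj.
  exact: (congr1 snd E).
exists (t1, t2); split=> [i|[u1 u2] uP].
  by rewrite /= /jet_res t1P t2P; case: (s i).
congr (_, _); [apply: t1U|apply: t2U] => i; by have := uP i; rewrite /= /jet_res => <-.
Qed.

End Sheaves.

Lemma push_sheaf k (Y X : ringed_space k) (p : morphism Y X) (F : pmod Y) :
  is_sheaf F -> is_sheaf (push p F).
Proof.
move=> shF U I v hv s cover agr.
have [||t [tP tU]] := shF (pre p U) I (fun i => pre p (v i))
   (fun i => pre_sub (hv i)) s.
- by move=> y Uy; have [i vi] := cover _ Uy; exists i.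
- move=> i j W hi hj.
  (* [W] need not be a preimage, so compatibility is taken over the intersection on X and then
     restricted to [W]. *)
  have hW : W <=o pre p (ocap (v i) (v j)).
    by move=> y Wy; split; [apply: (hi y)|apply: (hj y)].
  have s1 : ocap (v i) (v j) <=o v i by move=> ? [].
  have s2 : ocap (v i) (v j) <=o v j by move=> ? [].
  have := congr1 (res F hW) (agr i j _ s1 s2).
  by rewrite /= /push_res (res_comp _ hW hi) (res_comp _ hW hj).
by exists t; split.
Qed.

(** * Frames, generators and dual coordinates *)

Section Frames.
Variables (k : fieldType) (X : ringed_space k).
Implicit Types (U V W : opens X) (M N : pmod X).

Lemma frame_res M U V (h : V <=o U) r (e : 'I_r -> M U) :
  is_frame e -> is_frame (fun i => res M h (e i)).
Proof.
move=> fe W hW m; have [c [cP cU]] := fe W (subset_trans hW h) m.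
have E i : res M hW (res M h (e i)) = res M (subset_trans hW h) (e i).
  exact: res_comp.
exists c; split=> [|d dP]; first by rewrite cP; apply: eq_bigr => i _; rewrite E.
by apply: cU; rewrite dP; apply: eq_bigr => i _; rewrite E.
Qed.

(** A morphism is prescribed freely on a frame: linearity and naturality both follow from the
    uniqueness of coordinates. *)
Lemma frame_hom M N U r (e : 'I_r -> M U) (n : 'I_r -> N U) : is_frame e ->
  exists f : homs M N U, forall V (h : V <=o U) (c : 'I_r -> OO X V),
    f V h (\sum_(i < r) c i *: res M h (e i)) = \sum_(i < r) c i *: res N h (n i).
Proof.
move=> fe; pose co V (h : V <=o U) (m : M V) := sval (cid (fe V h m)).
have coP V (h : V <=o U) m : m = \sum_(i < r) co V h m i *: res M h (e i).
  by rewrite {1}(svalP (cid (fe V h m))).1.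
have coU V (h : V <=o U) m c : m = \sum_(i < r) c i *: res M h (e i) -> co V h m = c.
  exact: (svalP (cid (fe V h m))).2.
pose f V (h : V <=o U) m := \sum_(i < r) co V h m i *: res N h (n i).
have fl V (h : V <=o U) a (m m' : M V) : f V h (a *: m + m') = a *: f V h m + f V h m'.
  rewrite /f (coU _ _ _ (fun i => a * co V h m i + co V h m' i)).
    by rewrite scaler_sumr -big_split; apply: eq_bigr => i _; rewrite scalerDl scalerA.
  rewrite {1}(coP V h m) {1}(coP V h m') scaler_sumr -big_split.
  by apply: eq_bigr => i _; rewrite scalerDl scalerA.
have fn V V' (h : V <=o U) (h' : V' <=o V) (h'' : V' <=o U) (m : M V) :
    res N h' (f V h m) = f V' h'' (res M h' m).
  rewrite /f (coU _ _ _ (fun i => resO h' (co V h m i))).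
    by rewrite raddf_sum; apply: eq_bigr => i _; rewrite resZ (res_comp h h' h'').
  rewrite {1}(coP V h m) raddf_sum; apply: eq_bigr => i _.
  by rewrite resZ (res_comp h h' h'').
by exists (Homs fl fn) => V h c; rewrite /= /f (coU _ _ _ c).
Qed.

Lemma generatorP M U (m : M U) : is_generator m <->
  (forall V (h : V <=o U) n, exists a, n = a *: res M h m) /\
  (forall V (h : V <=o U) a, a *: res M h m = 0 -> a = 0).
Proof.
split=> [gm|[sp fr] V h n].
  split=> V h n; first by have [c [cP _]] := gm V h n; exists (c ord0); rewrite {1}cP big_ord1.
  move=> n0; have [c [cP cU]] := gm V h 0.
  have E1 : c = fun=> n by apply: cU; rewrite big_ord1 n0.
  have E2 : c = fun=> 0 by apply: cU; rewrite big_ord1 scale0r.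
  by have := congr1 (@^~ ord0) E1; rewrite E2.
have [a aP] := sp V h n; exists (fun=> a); split=> [|c]; rewrite big_ord1 // => E.
apply: functional_extensionality_dep => i; rewrite (ord1 i); apply/eqP.
rewrite -subr_eq0; apply/eqP/(fr V h).
by rewrite scalerBl -aP -E subrr.
Qed.

Lemma generator_res M U V (h : V <=o U) (m : M U) :
  is_generator m -> is_generator (res M h m).
Proof. exact: frame_res. Qed.

Lemma generator_inj M U (m : M U) V (h : V <=o U) a b : is_generator m ->
  a *: res M h m = b *: res M h m -> a = b.
Proof.
move=> /generatorP[_ fr] E; apply/eqP; rewrite -subr_eq0; apply/eqP/(fr V h).
by rewrite scalerBl E subrr.
Qed.

Lemma generator_span M U (m : M U) V (h : V <=o U) n : is_generator m ->
  exists a, n = a *: res M h m.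
Proof. by move=> /generatorP[sp _]; apply: sp. Qed.

Lemma dual_generator M U (w : M U) : is_generator w ->
  exists t : dual M U, forall V (h : V <=o U) a,
    t V h (a *: res M h w) = a.
Proof.
move=> gw; have [t tP] := frame_hom (fun=> 1 : Omod X U) gw.
exists t => V h a; have := tP V h (fun=> a); rewrite !big_ord1 => ->.
rewrite /= /resR rmorph1; exact: mulr1.
Qed.

(** Every t in the dual equals t(w) t0, where t0 is the coordinate dual to w; hence s(t) = t(w)
    s(t0), which says s = w (x) s(t0). *)
Lemma tensor_decomp M N U (w : M U) (t0 : dual M U) V (h : V <=o U)
    (s : tensor M N V) : is_generator w ->
  (forall V (h : V <=o U) a, t0 V h (a *: res M h w) = a) ->
  s = tens (res M h w) (s V (subo_refl V) (res (dual M) h t0)).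
Proof.
move=> gw t0P; apply: homs_eq => V' h' t; rewrite tensE.
rewrite (hom_nat s (subo_refl V) h' h') -homsZ; congr (s V' h' _).
apply: homs_eq => V'' h'' n /=.
have [a ->] := generator_span (subset_trans h'' (subset_trans h' h)) n gw.
have -> : t V'' h'' (a *: res M (subset_trans h'' (subset_trans h' h)) w)
  = a * resO h'' (t V' (subo_refl V') (res M h' (res M h w)) : OO X V').
  rewrite homsZ (res_comp h h' (subset_trans h' h)).
  have := hom_nat t (subo_refl V') h'' h'' (res M (subset_trans h' h) w).
  rewrite (res_comp (subset_trans h' h) h'' (subset_trans h'' (subset_trans h' h))).
  by rewrite /= /resR => <-.
have := t0P V'' (subset_trans h'' (subset_trans h' h)) a.
rewrite (homs_irr t0 _ (subset_trans (subset_trans h'' h') h)) => ->.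
exact: mulrC.
Qed.

End Frames.

(** * Units and affine opens *)

Section Units.
Variables (k : fieldType) (X : ringed_space k).
Implicit Types (U V W : opens X).

Lemma unit_at_res U V (h : V <=o U) (f : OO X U) x : oset V x ->
  unit_at (resO h f) x <-> unit_at f x.
Proof.
move=> Vx; split=> [[V' [h' [V'x [g fg]]]]|[V' [h' [V'x [g fg]]]]].
  exists V', (subset_trans h' h); split=> //; exists g.
  by rewrite -(resO_comp h h').
have s1 : ocap V V' <=o V by move=> ? [].
have s2 : ocap V V' <=o V' by move=> ? [].
exists (ocap V V'), s1; split=> //; exists (resO s2 g).
rewrite (resO_comp h s1 (subset_trans s1 h)) -(resO_comp h' s2 (subset_trans s1 h)).
by rewrite -rmorphM fg rmorph1.
Qed.

Lemma unit_atM U (f g : OO X U) x :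
  unit_at (f * g) x <-> unit_at f x /\ unit_at g x.
Proof.
split=> [[V [h [Vx [e E]]]]|].
  rewrite rmorphM in E; split; exists V, h; split=> //.
    by exists (resO h g * e); rewrite mulrA.
  by exists (resO h f * e); rewrite mulrCA mulrA.
move=> [[V [h [Vx [e E]]]] [V' [h' [Vx' [e' E']]]]].
have s1 : ocap V V' <=o V by move=> ? [].
have s2 : ocap V V' <=o V' by move=> ? [].
exists (ocap V V'), (subset_trans s1 h); split=> //.
exists (resO s1 e * resO s2 e').
rewrite rmorphM mulrACA -(resO_comp h s1) -(resO_comp h' s2 (subset_trans s1 h)).
by rewrite -!rmorphM E E' !rmorph1 mulr1.
Qed.

Lemma unit_at_inv U (f g : OO X U) x : oset U x -> f * g = 1 -> unit_at f x.
Proof. by move=> Ux E; exists U, (subo_refl U); split=> //; exists g; rewrite !resO_id. Qed.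

Lemma unit_at1 U x : oset U x -> unit_at (1 : OO X U) x.
Proof. by move=> Ux; apply: (@unit_at_inv _ _ 1) => //; rewrite mulr1. Qed.

Lemma unit_atX U (f : OO X U) n x : oset U x -> unit_at f x -> unit_at (f ^+ n) x.
Proof.
move=> Ux fx; elim: n => [|n IH]; first by rewrite expr0; apply: unit_at1.
by rewrite exprS; apply/unit_atM.
Qed.

Lemma unit_at_inside U (f : OO X U) x : unit_at f x -> oset U x.
Proof. by move=> [V [h [Vx _]]]; exact: h. Qed.

Lemma unit_glue U (f : OO X U) : is_sheaf (Omod X) ->
  (forall x, oset U x -> unit_at f x) -> exists g, f * g = 1.
Proof.
move=> shO fU.
pose Q V (h : V <=o U) (g : Omod X V) := resO h f * (g : OO X V) = 1.
have [||g gP] := @sheaf_glue _ _ (Omod X) U Q shO.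
- by move=> x /fU[V [h [Vx [g E]]]]; exists V, h, g.
- move=> V V' h h' g g' W s s' E E'.
  rewrite /= /resR.
  have {}E := congr1 (resO s) E; have {}E' := congr1 (resO s') E'.
  rewrite rmorphM rmorph1 (resO_comp h s (subset_trans s h)) in E.
  rewrite rmorphM rmorph1 (resO_comp h' s' (subset_trans s h)) in E'.
  by rewrite -[LHS]mulr1 -E' mulrA [resO s g * _]mulrC E mul1r.
exists (g : OO X U).
apply: (@sheaf_sep _ _ (Omod X)) => // x /fU[V [h [Vx [e E]]]].
exists V, h; split=> //.
rewrite /= /resR rmorphM rmorph1; have := gP V h e E.
by rewrite /= /resR => ->.
Qed.

Lemma generator_unit (M : pmod X) U (m : M U) (f g : OO X U) : f * g = 1 ->
  is_generator m -> is_generator (f *: m).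
Proof.
move=> fg gm; have /generatorP[sp fr] := gm; apply/generatorP; split=> V h n.
  have [a ->] := sp V h n; exists (a * resO h g).
  by rewrite resZ scalerA -mulrA [resO h g * _]mulrC -rmorphM fg rmorph1 mulr1.
rewrite resZ scalerA => /fr E.
by rewrite -[n]mulr1 -(rmorph1 (resO h)) -fg rmorphM mulrA E mul0r.
Qed.

(** Local coefficients with respect to m are unique, hence agree on overlaps and glue to a section
    of O. *)
Lemma generator_local (M : pmod X) U (m : M U) :
  is_sheaf (Omod X) -> is_sheaf M ->
  (forall x, oset U x -> exists V (h : V <=o U),
     oset V x /\ is_generator (res M h m)) -> is_generator m.
Proof.
move=> shO shM loc; apply/generatorP; split=> V h n.
  pose Q W (g : W <=o V) (a : Omod X W) := is_generator (res M (subset_trans g h) m) /\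
    res M g n = (a : OO X W) *: res M (subset_trans g h) m.
  have [||a aP] := @sheaf_glue _ _ (Omod X) V Q shO.
  - move=> x Vx; have [W [g [Wx gW]]] := loc x (h x Vx).
    have s1 : ocap V W <=o V by move=> ? [].
    have s2 : ocap V W <=o W by move=> ? [].
    have gg : is_generator (res M (subset_trans s1 h) m).
      by rewrite -(res_comp g s2); apply: generator_res.
    have [a aP] := generator_span (subo_refl _) (res M s1 n) gg.
    by rewrite res_id in aP; exists (ocap V W), s1, a.
  - move=> W W' s s' a a' Z g g' [G E] [_ E'].
    apply: (generator_inj (h := g) G).
    rewrite /= /resR -resZ -E (res_comp s g (subset_trans g s)).
    rewrite (res_comp _ g (subset_trans (subset_trans g s) h)).
    rewrite -(res_comp (subset_trans s' h) g' (subset_trans (subset_trans g s) h)).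
    by rewrite -resZ -E' (res_comp s' g' (subset_trans g s)).
  exists (a : OO X V); apply: sheaf_sep => // x Vx; have [W [g [Wx gW]]] := loc x (h x Vx).
  have s1 : ocap V W <=o V by move=> ? [].
  have s2 : ocap V W <=o W by move=> ? [].
  have gg : is_generator (res M (subset_trans s1 h) m).
    by rewrite -(res_comp g s2); apply: generator_res.
  have [b bP] := generator_span (subo_refl _) (res M s1 n) gg.
  rewrite res_id in bP; exists (ocap V W), s1; split=> //.
  have E := aP _ s1 b (conj gg bP).
  by rewrite bP resZ (res_comp h s1 (subset_trans s1 h)); congr (_ *: _); rewrite -E.
move=> E; apply: (@sheaf_sep _ _ (Omod X)) => // x Vx; have [W [g [Wx gW]]] := loc x (h x Vx).
have s1 : ocap V W <=o V by move=> ? [].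
have s2 : ocap V W <=o W by move=> ? [].
exists (ocap V W), s1; split=> //; rewrite raddf0.
apply: (generator_inj (h := s2) gW); rewrite scale0r.
by rewrite (res_comp g s2 (subset_trans s1 h)) -(res_comp h s1) -resZ E raddf0.
Qed.

End Units.

Section Affine.
Variables (k : fieldType) (X : ringed_space k).
Implicit Types (U V W : opens X).

Fact basic_open_subproof U (f : OO X U) : open [set x | unit_at f x].
Proof.
rewrite openE => x [V [h [Vx [g E]]]].
rewrite /interior nbhsE; exists (oset V); first by split=> //; exact: oset_open.
by move=> y Vy; exists V, h; split=> //; exists g.
Qed.

Definition basic_open U (f : OO X U) : opens X := Opens (basic_open_subproof f).

Lemma basic_sub U (f : OO X U) : basic_open f <=o U.
Proof. by move=> x; apply: unit_at_inside. Qed.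
Arguments basic_sub {U} f.

Lemma basic_unit U (f : OO X U) : is_sheaf (Omod X) ->
  exists g, resO (basic_sub f) f * g = 1.
Proof. by move=> shO; apply: unit_glue => // x fx; apply/unit_at_res. Qed.

Lemma basic_frac U (f : OO X U) (g : OO X (basic_open f)) : affine U ->
  exists n a, resO (basic_sub f) f ^+ n * g = resO (basic_sub f) a.
Proof.
case=> _ _ _ loc; have [fr _] := loc f _ (basic_sub f) (fun y => conj
  (fun fy => conj (unit_at_inside fy) fy) (fun fy => proj2 fy)).
exact: fr.
Qed.

Lemma affine_nonunitD U x (a b : OO X U) : affine U -> oset U x ->
  unit_at (a + b) x -> unit_at a x \/ unit_at b x.
Proof.
case=> pr _ _ _ Ux; have [_ nD _ _ _] := pr x Ux => ab.
by apply: contrapT => /not_orP[na nb]; apply: (nD a b na nb).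
Qed.

Lemma affine_nonunit0 U x : affine U -> oset U x -> ~ unit_at (0 : OO X U) x.
Proof. by case=> pr _ _ _ Ux; have [n0 _ _ _ _] := pr x Ux. Qed.

(** Every section over D(f) is a / f^n with a in O(U), so units, primes and localisations over D(f)
    are read off on numerators. A prime [P] of O(D(f)) contracts to the prime [Q], whose point lies
    in D(f) because f is not in [Q]. *)
Lemma affine_basic U (f : OO X U) : is_sheaf (Omod X) -> affine U ->
  affine (basic_open f).
Proof.
move=> shO aU; have [pr pt base loc] := aU.
set V := basic_open f; set h := basic_sub f.
have [e fe] := basic_unit f shO.
have fu n : resO h f ^+ n * e ^+ n = 1 by rewrite -exprMn fe expr1n.
have nonE x (g : OO X V) n a : oset V x -> resO h f ^+ n * g = resO h a ->
    unit_at g x <-> unit_at a x.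
  move=> Vx E; rewrite -(unit_at_res h a Vx) -E unit_atM; split=> [|[]//].
  by split=> //; apply: unit_atX => //; apply/unit_at_res.
split.
- move=> x Vx; have Ux := unit_at_inside Vx; split.
  + move=> n0; apply: (affine_nonunit0 aU Ux).
    by rewrite -(unit_at_res h 0 Vx) rmorph0.
  + move=> a b na nb ab.
    have [n [a1 E1]] := basic_frac a aU; have [m [b1 E2]] := basic_frac b aU.
    have E1' : resO h f ^+ (n + m) * a = resO h (f ^+ m * a1).
      by rewrite rmorphM -E1 rmorphXn exprD mulrCA mulrA.
    have E2' : resO h f ^+ (n + m) * b = resO h (f ^+ n * b1).
      by rewrite rmorphM -E2 rmorphXn exprD mulrA.
    have E3 : resO h f ^+ (n + m) * (a + b) = resO h (f ^+ m * a1 + f ^+ n * b1).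
      by rewrite mulrDr E1' E2' rmorphD.
    have [] := affine_nonunitD aU Ux ((nonE _ _ _ _ Vx E3).1 ab).
      by move/(nonE _ _ _ _ Vx E1').
    by move/(nonE _ _ _ _ Vx E2').
  + by move=> a b nb /unit_atM[].
  + by move=> n1; apply/n1/unit_at1.
  + move=> a b nab; apply: contrapT => /not_orP[/contrapT ua /contrapT ub].
    by apply: nab; apply/unit_atM.
- move=> P [P0 PD PM P1 Pp].
  pose Q : set (OO X U) := [set a | P (resO h a)].
  have uP (a b : OO X V) : a * b = 1 -> ~ P a.
    by move=> ab Pa; apply: P1; rewrite -ab mulrC; apply: PM.
  have PE (g : OO X V) n a : resO h f ^+ n * g = resO h a -> P g <-> Q a.
    move=> E; rewrite /Q /= -E; split=> [|/Pp[Pf|//]]; first exact: PM.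
    by case: (uP _ _ (fu n)).
  have prQ : prime_ideal Q.
    split; rewrite /Q /=.
    + by rewrite rmorph0.
    + by move=> a b Pa Pb; rewrite rmorphD; apply: PD.
    + by move=> a b Pb; rewrite rmorphM; apply: PM.
    + by rewrite rmorph1.
    + by move=> a b; rewrite rmorphM => /Pp.
  have [x [[Ux Qx] xU]] := pt Q prQ.
  have Vx : oset V x.
    apply: contrapT => nf; have : Q f by rewrite -Qx.
    exact: uP fe.
  have Px y : oset V y -> @nonunits _ _ U y = Q -> @nonunits _ _ V y = P.
    move=> Vy Qy; apply/funext => g; apply/propext.
    have [n [a E]] := basic_frac g aU; rewrite (PE _ _ _ E) -Qy.
    by rewrite /nonunits /= (nonE _ _ _ _ Vy E).
  exists x; split=> [|y [Vy Py]]; first by split=> //; apply: Px.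
  apply: xU; split; first exact: unit_at_inside Vy.
  apply/funext => a; apply/propext; rewrite /Q /= -Py /nonunits /=.
  by rewrite unit_at_res.
- move=> W x hW Wx; have [g [gx gW]] := base W x (subset_trans hW h) Wx.
  have Vx := hW x Wx; exists (resO h g); split; first exact/unit_at_res.
  by move=> y Vy /(unit_at_res _ _ Vy) gy; apply: gW => //; apply: unit_at_inside Vy.
- move=> g W hW WE.
  have [n [a E]] := basic_frac g aU.
  (* As f^n g = a over D(f), the open D(g) of D(f) is the open D(f a) of U, to which the
     localisation clause for U applies. *)
  have WE' y : oset W y <-> oset U y /\ unit_at (f * a) y.
    rewrite WE unit_atM; split=> [[Vy]|[Uy [Vy ay]]].
      by rewrite (nonE _ _ _ _ Vy E) => ay; split=> //; apply: unit_at_inside Vy.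
    by split=> //; apply/(nonE _ _ _ _ Vy E).
  have [fr tors] := loc (f * a) W (subset_trans hW h) WE'.
  have Efa : resO h (f * a) = resO h f ^+ n.+1 * g.
    by rewrite rmorphM -E mulrA exprS.
  split=> [s|b b0].
    have [m [c Ec]] := fr s.
    (* Here (f a)^m s = c and f a = f^(n+1) g, so g^m s = e^((n+1)m) c, with e the inverse of f. *)
    exists m, (e ^+ (n.+1 * m) * resO h c).
    rewrite rmorphM (resO_comp h hW (subset_trans hW h)) -Ec mulrA; congr (_ * _).
    rewrite -(resO_comp h hW) Efa -!rmorphXn -rmorphM; congr (resO hW _).
    by rewrite exprMn rmorphXn -exprM mulrA [e ^+ _ * _]mulrC fu mul1r.
  have [l [c Ec]] := basic_frac b aU.
  have [|m Em] := tors c.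
    by rewrite -(resO_comp h hW) -Ec rmorphM b0 mulr0.
  exists m; have := congr1 (resO h) Em; rewrite rmorphM rmorphXn Efa -Ec rmorph0.
  (* The relation reads f^((n+1)m) g^m f^l b = 0; the power of e cancels all powers of f. *)
  move=> /(congr1 (fun z => e ^+ (n.+1 * m + l) * z)); rewrite mulr0 => <-.
  rewrite -[LHS]mul1r -(fu (n.+1 * m + l)%N) exprMn -exprM exprD; ring.
Qed.

(* Quasi-compactness: an ideal of O(U) lying in no prime is the unit ideal. *)
Lemma affine_ind U (P : OO X U -> Prop) : affine U ->
  P 0 -> (forall a b, P a -> P b -> P (a + b)) -> (forall a b, P b -> P (a * b)) ->
  (forall x, oset U x -> exists2 f, unit_at f x & P f) -> P 1.
Proof.
move=> aU P0 PD PM Px; apply: contrapT => P1.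
pose ideal (S : set (OO X U)) := [/\ S 0, (forall a b, S a -> S b -> S (a + b)),
  (forall a b, S b -> S (a * b)), ~ S 1 & P `<=` S].
have [|M [[M0|[M0 MD MM M1 PMm]] Mmax]] :=
  @Zorn_bigcup _ (fun S => S = set0 \/ ideal S).
- move=> F Fid Ftot; have [[S0 [FS0 IS0]]|noS] := pselect (exists S, F S /\ ideal S).
    right; split.
    + by exists S0 => //; case: IS0.
    + move=> a b [S FS Sa] [S' FS' Sb].
      have [le|le] := Ftot S S' FS FS'.
        exists S' => //; case: (Fid S' FS') => [E|[_ D _ _ _]]; first by rewrite E in Sb.
        by apply: D => //; apply: le.
      exists S => //; case: (Fid S FS) => [E|[_ D _ _ _]]; first by rewrite E in Sa.
      by apply: D => //; apply: le.
    + move=> a b [S FS Sb]; exists S => //.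
      by case: (Fid S FS) => [E|[_ _ D _ _]]; [rewrite E in Sb|apply: D].
    + move=> [S FS S1]; case: (Fid S FS) => [E|[_ _ _ D _]]; last exact: D.
      by rewrite E in S1.
    + by move=> a Pa; exists S0 => //; case: IS0 => _ _ _ _; apply.
  left; apply/seteqP; split=> // a [S FS Sa]; case: (Fid S FS) => [E|IS].
    by rewrite E in Sa.
  by case: noS; exists S.
- apply: (Mmax P); last by right; split.
  by rewrite M0; split=> //; move/(_ 0 P0).
have prM : prime_ideal M.
  split=> // a b Mab; apply: contrapT => /not_orP[na nb].
  (* otherwise M + (a) is a larger proper ideal *)
  have big c : ~ M c -> exists2 m, M m & exists d, m + d * c = 1.
    move=> Mc; pose S := [set x | exists2 m, M m & exists d, m + d * c = x].
    apply: contrapT => nS1; apply: (Mmax S).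
      split; first by move=> m Mm; exists m => //; exists 0; rewrite mul0r addr0.
      by move=> SM; apply/Mc/SM; exists 0 => //; exists 1; rewrite mul1r add0r.
    right; split.
    + by exists 0 => //; exists 0; rewrite mul0r addr0.
    + move=> x y [m Mm [d <-]] [m' Mm' [d' <-]].
      by exists (m + m'); [exact: MD|exists (d + d'); ring].
    + move=> x y [m Mm [d <-]].
      by exists (x * m); [exact: MM|exists (x * d); ring].
    + exact: nS1.
    + by move=> x Ix; exists x; [exact: PMm|exists 0; rewrite mul0r addr0].
  have [m Mm [d E]] := big a na; have [m' Mm' [d' E']] := big b nb.
  apply: M1; rewrite -[1]mulr1 -{1}E -E'.
  have -> : (m + d * a) * (m' + d' * b) =
    (m' + d' * b) * m + (d * a) * m' + (d * d') * (a * b) by ring.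
  by apply: (MD); [apply: (MD)|]; apply: (MM).
have [_ pt _ _] := aU; have [x [[Ux Mx] _]] := pt M prM.
have [f fx Pf] := Px x Ux.
by have := PMm f Pf; rewrite -Mx; apply.
Qed.

Lemma affine_base U V x : affine U -> oset V x -> oset U x ->
  exists f : OO X U, oset (basic_open f) x /\ basic_open f <=o V.
Proof.
case=> _ _ base _ Vx Ux.
have s1 : ocap U V <=o U by move=> ? [].
have [f [fx fV]] := base (ocap U V) x s1 (conj Ux Vx).
by exists f; split=> // y fy; case: (fV y (unit_at_inside fy) fy).
Qed.

End Affine.
Arguments basic_sub {k X U} f.

(** Proves inclusions between intersections of opens by closing the memberships of a point under the
    inclusions in the context. *)
Ltac subo :=
  let u := fresh "u" in let Hu := fresh "Hu" in
  intros u Hu;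
  repeat match goal with
  | [ H : oset (ocap ?A ?B) u |- _ ] =>
      lazymatch goal with
      | [ _ : oset A u, _ : oset B u |- _ ] => fail
      | _ => pose proof (proj1 H); pose proof (proj2 H)
      end
  | [ h : oset ?A `<=` oset ?B, H : oset ?A u |- _ ] =>
      lazymatch goal with
      | [ _ : oset B u |- _ ] => fail
      | _ => pose proof (h u H)
      end
  end;
  repeat (assumption || split).

(** * Vanishing of cocycles on affine opens *)

Section AffineVanishing.

Lemma subr_swap (A : zmodType) (a b c d : A) : d - b = c - a -> a - b = c - d.
Proof. by move=> E; rewrite -[a](subKr c) -E opprB addrA addrAC addrK. Qed.

Lemma bezoutX (A : comPzRingType) (x y u v : A) n : u * x + v * y = 1 ->
  exists a b, a * x ^+ n + b * y ^+ n = 1.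
Proof.
have step (z t : A) m : (exists a b, a * z + b * t = 1) ->
    exists a b, a * z ^+ m + b * t = 1.
  move=> [a [b E]]; elim: m => [|m [a' [b' E']]].
    by exists 1, 0; rewrite expr0 mul0r addr0 mulr1.
  exists (a' * a), (a' * z ^+ m * b + b' * (a * z + b * t)).
  by rewrite -[RHS]mulr1 -{1}E' -E exprS; ring.
move=> E; have [] : exists a b, a * y ^+ n + b * x ^+ n = 1; last first.
  by move=> b [a E']; exists a, b; rewrite addrC.
have [a [b E']] := step x y n (ex_intro _ u (ex_intro _ v E)).
by apply: step; exists b, a; rewrite addrC.
Qed.

Variables (k : fieldType) (X : ringed_space k).
Implicit Types (U V W : opens X).

(* The f for which the cocycle bounds over D(f) form an ideal: over D(f + g) the
   difference of two primitives is a section over D(fg), which a partition of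
   unity a f^n + b g^n = 1 splits into sections over D(f) and D(g). *)
Lemma affine_coboundary W (F : pmod X) (eta : F W) (c : cocycle W F) :
  is_sheaf (Omod X) -> is_sheaf F -> affine W -> is_generator eta ->
  exists b : forall y, F (cov c y),
    forall y z V (hy : V <=o cov c y) (hz : V <=o cov c z)
      (hc : V <=o ocap (cov c y) (cov c z)),
    res F hc (coc c y z) = res F hz (b z) - res F hy (b y).
Proof.
move=> shO shF aW geta.
pose P (g : OO X W) := exists b : forall y, F (ocap (cov c y) (basic_open g)),
  forall y z V (hy : V <=o ocap (cov c y) (basic_open g))
    (hz : V <=o ocap (cov c z) (basic_open g))
    (hc : V <=o ocap (cov c y) (cov c z)),
  res F hc (coc c y z) = res F hz (b z) - res F hy (b y).
have P1 : P 1; last first.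
  have [b bP] := P1.
  have s y : cov c y <=o ocap (cov c y) (basic_open (1 : OO X W)).
    by move=> u cu; split=> //; apply/unit_at1/(cov_sub cu).
  exists (fun y => res F (s y) (b y)) => y z V hy hz hc.
  rewrite (res_comp (s y) hy (subset_trans hy (s y))).
  rewrite (res_comp (s z) hz (subset_trans hz (s z))); exact: bP.
apply: (affine_ind aW).
- exists (fun=> 0) => y z V hy hz hc; apply: sheaf_empty => // x /hy[_ gx].
  by apply: (affine_nonunit0 aW (unit_at_inside gx)).
- move=> g g' [b bP] [b' bP'].
  set D := basic_open (g + g'); set B := basic_open g; set B' := basic_open g'.
  set I := basic_open (g * g').
  have IB : I <=o B by move=> u /unit_atM[].
  have IB' : I <=o B' by move=> u /unit_atM[].
  have BI u : oset B u -> oset B' u -> oset I u by move=> ? ?; apply/unit_atM.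
  have DBB u : oset D u -> oset B u \/ oset B' u.
    by move=> Du; apply: affine_nonunitD => //; apply: unit_at_inside Du.
  have IW : I <=o W := basic_sub _.
  have DW : D <=o W := basic_sub _.
  have BW : B <=o W := basic_sub _.
  have BW' : B' <=o W := basic_sub _.
  (* Over D(g g') the differences b_y - b'_y do not depend on y, since b and b' have the same
     coboundary; they glue to [d]. *)
  have [d dP] : exists d : F I, forall y V (h : V <=o I)
      (hb : V <=o ocap (cov c y) B) (hb' : V <=o ocap (cov c y) B'),
      res F h d = res F hb (b y) - res F hb' (b' y).
    pose Q V (h : V <=o I) (s : F V) := exists y (hb : V <=o ocap (cov c y) B)
      (hb' : V <=o ocap (cov c y) B'), s = res F hb (b y) - res F hb' (b' y).
    have [||d dP] := @sheaf_glue _ _ F I Q shF.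
    + move=> x Ix; have cx : oset (cov c x) x by apply/cov_in/IW.
      have s1 : ocap (cov c x) I <=o I by move=> ? [].
      have s2 : ocap (cov c x) I <=o ocap (cov c x) B by subo.
      have s3 : ocap (cov c x) I <=o ocap (cov c x) B' by subo.
      exists (ocap (cov c x) I), s1, (res F s2 (b x) - res F s3 (b' x)).
      by split=> //; exists x, s2, s3.
    + move=> V V' h h' s s' T t t' [y [hb [hb' ->]]] [z [hz [hz' ->]]].
      have hc : T <=o ocap (cov c y) (cov c z) by subo.
      have := bP y z T (subset_trans t hb) (subset_trans t' hz) hc.
      rewrite (bP' y z T (subset_trans t hb') (subset_trans t' hz') hc).
      rewrite !raddfB (res_comp hb t (subset_trans t hb)).
      rewrite (res_comp hb' t (subset_trans t hb')).
      rewrite (res_comp hz t' (subset_trans t' hz)).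
      rewrite (res_comp hz' t' (subset_trans t' hz')) /= => E.
      exact: subr_swap.
    by exists d => y V h hb hb'; apply: dP; exists y, hb, hb'.
  (* [del] is the coefficient of [d] along [eta], and (g g')^n del is the restriction of a function
     [a] on W. *)
  have [del delP] := generator_span IW d geta.
  have [n [a aP]] := basic_frac del aW.
  have [e eP] := basic_unit g shO; have [e' eP'] := basic_unit g' shO.
  have [f fP] := basic_unit (g + g') shO.
  (* Over [D] the sum g + g' has inverse [f], so f g + f g' = 1; passing to n-th powers gives al g^n
     + be g'^n = 1. *)
  have [|al [be abP]] := @bezoutX _ (resO DW g) (resO DW g') f f n.
    by rewrite -mulrDr -rmorphD mulrC -[RHS]fP (Prop_irrelevance DW (basic_sub _)).
  pose A1 := ocap D B; pose A2 := ocap D B'.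
  have A1D : A1 <=o D by move=> ? [].
  have A1B : A1 <=o B by move=> ? [].
  have A2D : A2 <=o D by move=> ? [].
  have A2B : A2 <=o B' by move=> ? [].
  (* [e1] is (be a / g^n) eta and [e2] is (al a / g'^n) eta. Over D(g g') they become be g'^n d and
     al g^n d, with sum [d]. *)
  pose e1 : F A1 := (resO A1D be * resO A1B (resO BW a * e ^+ n)) *:
     res F (subset_trans A1B BW) eta.
  pose e2 : F A2 := (resO A2D al * resO A2B (resO BW' a * e' ^+ n)) *:
     res F (subset_trans A2B BW') eta.
  have e12 V (h1 : V <=o A1) (h2 : V <=o A2) (hI : V <=o I) :
      res F h1 e1 + res F h2 e2 = res F hI d.
    have hW := subset_trans hI IW.
    have hD : V <=o D by subo.
    rewrite delP /e1 /e2 !resZ (res_comp _ hI hW) (res_comp _ h1 hW) (res_comp _ h2 hW).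
    rewrite -scalerDl; congr (_ *: _).
    rewrite !rmorphM (resO_comp A1D h1 hD) (resO_comp A2D h2 hD).
    rewrite (resO_comp A1B h1 (subset_trans h1 A1B)) (resO_comp A2B h2 (subset_trans h2 A2B)).
    rewrite (resO_comp A1B h1 (subset_trans h1 A1B)) (resO_comp A2B h2 (subset_trans h2 A2B)).
    rewrite (resO_comp BW _ hW) (resO_comp BW' _ hW) !rmorphXn.
    have {}eP := congr1 (resO (subset_trans h1 A1B)) eP.
    have {}eP' := congr1 (resO (subset_trans h2 A2B)) eP'.
    have {}aP := congr1 (resO hI) aP; have {}abP := congr1 (resO hD) abP.
    move: eP eP' aP abP; rewrite !(rmorphM, rmorphD, rmorphXn, rmorph1).
    rewrite (resO_comp _ (subset_trans h1 A1B) hW) (resO_comp _ (subset_trans h2 A2B) hW).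
    rewrite !(resO_comp _ hI hW) (resO_comp _ hD hW) (resO_comp _ hD hW).
    set x := resO hW g; set x' := resO hW g'; set a1 := resO hW a.
    set y := resO _ e; set y' := resO _ e'; set al1 := resO hD al; set be1 := resO hD be.
    set z := resO hI del => xy xy' <- ab.
    have {}xy : x ^+ n * y ^+ n = 1 by rewrite -exprMn xy expr1n.
    have {}xy' : x' ^+ n * y' ^+ n = 1 by rewrite -exprMn xy' expr1n.
    transitivity (be1 * x' ^+ n * z * (x ^+ n * y ^+ n) + al1 * x ^+ n * z * (x' ^+ n * y' ^+ n)).
      by rewrite !exprMn; ring.
    by rewrite xy xy' !mulr1 -mulrDl addrC ab mul1r.
  (* The corrected primitives b_y - e1 over D(g) and b'_y + e2 over D(g') agree on the overlap,
     since e1 + e2 = d = b_y - b'_y there. *)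
  have ex y : exists t : F (ocap (cov c y) D),
      (forall V (h : V <=o ocap (cov c y) D) (h1 : V <=o A1)
         (hb : V <=o ocap (cov c y) B),
         res F h t = res F hb (b y) - res F h1 e1) /\
      (forall V (h : V <=o ocap (cov c y) D) (h2 : V <=o A2)
         (hb : V <=o ocap (cov c y) B'),
         res F h t = res F hb (b' y) + res F h2 e2).
    pose Q V (h : V <=o ocap (cov c y) D) (s : F V) :=
      (exists (h1 : V <=o A1) (hb : V <=o ocap (cov c y) B),
         s = res F hb (b y) - res F h1 e1) \/
      (exists (h2 : V <=o A2) (hb : V <=o ocap (cov c y) B'),
         s = res F hb (b' y) + res F h2 e2).
    have [||t tP] := @sheaf_glue _ _ F _ Q shF.
    + move=> x [cx Dx]; have [Bx|Bx] := DBB x Dx.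
        have s : ocap (ocap (cov c y) D) B <=o ocap (cov c y) D by subo.
        have s1 : ocap (ocap (cov c y) D) B <=o A1 by subo.
        have s2 : ocap (ocap (cov c y) D) B <=o ocap (cov c y) B by subo.
        exists _, s, (res F s2 (b y) - res F s1 e1); split=> //.
        by left; exists s1, s2.
      have s : ocap (ocap (cov c y) D) B' <=o ocap (cov c y) D by subo.
      have s1 : ocap (ocap (cov c y) D) B' <=o A2 by subo.
      have s2 : ocap (ocap (cov c y) D) B' <=o ocap (cov c y) B' by subo.
      exists _, s, (res F s2 (b' y) + res F s1 e2); split=> //.
      by right; exists s1, s2.
    + have mix V V' T (t : T <=o V) (t' : T <=o V') (h1 : V <=o A1)
          (hb : V <=o ocap (cov c y) B) (h2 : V' <=o A2) (hb' : V' <=o ocap (cov c y) B') :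
        res F t (res F hb (b y) - res F h1 e1) = res F t' (res F hb' (b' y) + res F h2 e2).
        have hI : T <=o I 
          by move=> u Tu; apply: BI; [case: (hb u (t u Tu))|case: (hb' u (t' u Tu))].
        rewrite raddfB raddfD (res_comp hb t (subset_trans t hb)).
        rewrite (res_comp h1 t (subset_trans t h1)).
        rewrite (res_comp hb' t' (subset_trans t' hb')) (res_comp h2 t' (subset_trans t' h2)).
        have := dP y T hI (subset_trans t hb) (subset_trans t' hb').
        rewrite -(e12 T (subset_trans t h1) (subset_trans t' h2)) /= => E.
        apply/eqP; rewrite subr_eq -addrA [res F _ e2 + _]addrC E.
        by rewrite addrC subrK.
      move=> V V' h h' s s' T t t' [[h1 [hb ->]]|[h2 [hb ->]]] [[h1' [hb' ->]]|[h2' [hb' ->]]].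
      * rewrite !raddfB (res_comp _ t (subset_trans t hb)) (res_comp _ t (subset_trans t h1)).
        by rewrite (res_comp _ t' (subset_trans t hb)) (res_comp _ t' (subset_trans t h1)).
      * exact: mix.
      * exact/esym/mix.
      * rewrite !raddfD (res_comp _ t (subset_trans t hb)) (res_comp _ t (subset_trans t h2)).
        by rewrite (res_comp _ t' (subset_trans t hb)) (res_comp _ t' (subset_trans t h2)).
    by exists t; split=> V h h1 hb; apply: tP; [left|right]; exists h1, hb.
  exists (fun y => sval (cid (ex y))) => y z V hy hz hc.
  have [y1 y2] := svalP (cid (ex y)); have [z1 z2] := svalP (cid (ex z)).
  have VD : V <=o D by subo.
  apply: sheaf_sep => // x Vx; have [Bx|Bx] := DBB x (VD x Vx).
    have s : ocap V B <=o V by subo.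
    have sA : ocap V B <=o A1 by subo.
    have sy : ocap V B <=o ocap (cov c y) B by subo.
    have sz : ocap V B <=o ocap (cov c z) B by subo.
    exists (ocap V B), s; split=> //; rewrite raddfB.
    rewrite (res_comp _ s (subset_trans s hy)) (res_comp _ s (subset_trans s hz)).
    rewrite (res_comp _ s (subset_trans s hc)) /=.
    rewrite (y1 _ (subset_trans s hy) sA sy) (z1 _ (subset_trans s hz) sA sz).
    by rewrite (bP y z _ sy sz) opprB addrA subrK.
  have s : ocap V B' <=o V by subo.
  have sA : ocap V B' <=o A2 by subo.
  have sy : ocap V B' <=o ocap (cov c y) B' by subo.
  have sz : ocap V B' <=o ocap (cov c z) B' by subo.
  exists (ocap V B'), s; split=> //; rewrite raddfB.
  rewrite (res_comp _ s (subset_trans s hy)) (res_comp _ s (subset_trans s hz)).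
  rewrite (res_comp _ s (subset_trans s hc)) /=.
  rewrite (y2 _ (subset_trans s hy) sA sy) (z2 _ (subset_trans s hz) sA sz).
  by rewrite (bP' y z _ sy sz) opprD addrACA subrr addr0.
- move=> a g [b bP].
  have ag : basic_open (a * g) <=o basic_open g by move=> u /unit_atM[].
  have s y : ocap (cov c y) (basic_open (a * g)) <=o ocap (cov c y) (basic_open g).
    by move=> u [cu gu]; split=> //; apply: ag.
  exists (fun y => res F (s y) (b y)) => y z V hy hz hc.
  rewrite (res_comp _ hy (subset_trans hy (s y))) (res_comp _ hz (subset_trans hz (s z))).
  exact: bP.
(* Over a D(g) contained in [cov c x], the sections c_{x,y} themselves form a primitive, by the
   cocycle law. *)
- move=> x Wx; have [g [gx gc]] := affine_base aW (cov_in c Wx) Wx.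
  exists g => //.
  have s y : ocap (cov c y) (basic_open g) <=o ocap (cov c x) (cov c y).
    by move=> u [cu gu]; split=> //; apply: gc.
  exists (fun y => res F (s y) (coc c x y)) => y z V hy hz hc.
  rewrite (res_comp _ hy (subset_trans hy (s y))) (res_comp _ hz (subset_trans hz (s z))).
  rewrite -(coc_law (subset_trans hy (s y)) hc (subset_trans hz (s z))).
  by rewrite addrAC subrr add0r.
Qed.

End AffineVanishing.

(** * Functoriality of H1 *)

Section Cohomology.
Variables (k : fieldType) (X : ringed_space k).
Implicit Types (U V W : opens X) (F G : pmod X).

(** An isomorphism of sheaves over [W] only: [psi] is used as one over the etale locus, where dp w
    generates [OmY]. *)
Definition bij_over F G (f : mor F G) W := forall V, V <=o W ->
  (forall m : F V, ap f m = 0 -> m = 0) /\ (forall n : G V, exists m, ap f m = n).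

Lemma bij_over_inj F G (f : mor F G) W V (m m' : F V) : bij_over f W ->
  V <=o W -> ap f m = ap f m' -> m = m'.
Proof.
move=> bf hV E; apply/eqP; rewrite -subr_eq0; apply/eqP.
by apply: (bf V hV).1; rewrite apB E subrr.
Qed.

Lemma bij_over_local F G (f : mor F G) W : is_sheaf F -> is_sheaf G ->
  (forall x, oset W x -> exists U, oset U x /\ bij_over f U) -> bij_over f W.
Proof.
move=> shF shG loc V hV.
have s1 (A B : opens X) : ocap A B <=o A by move=> ? [].
have s2 (A B : opens X) : ocap A B <=o B by move=> ? [].
split=> [m m0|n].
  apply: sheaf_sep => // x Vx; have [U [Ux bU]] := loc x (hV x Vx).
  exists (ocap V U), (s1 _ _); split=> //; apply: (bij_over_inj bU) => //.
  by rewrite -!ap_res m0 /ap homs0.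
(* Bijectivity over [A] is part of [Q], so that two local preimages agree where they meet. *)
pose Q A (h : A <=o V) (m : F A) := ap f m = res G h n /\ bij_over f A.
have [||m mP] := @sheaf_glue _ _ F V Q shF.
- move=> x Vx; have [U [Ux bU]] := loc x (hV x Vx).
  have [m Em] := (bU _ (s2 V U)).2 (res G (s1 V U) n).
  exists (ocap V U), (s1 V U), m; split=> //; split=> // A hA.
  exact: (bU A (subset_trans hA (s2 V U))).
- move=> A A' h h' m m' T t t' [Em bA] [Em' _].
  apply: (bij_over_inj bA t); rewrite -!ap_res Em Em'.
  by rewrite (res_comp h t (subset_trans t h)) (res_comp h' t' (subset_trans t h)).
exists m; apply: sheaf_sep => // x Vx; have [U [Ux bU]] := loc x (hV x Vx).
have [m' Em'] := (bU _ (s2 V U)).2 (res G (s1 V U) n).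
exists (ocap V U), (s1 V U); split=> //; rewrite ap_res -Em'; congr (ap f _).
apply: mP; split=> // A hA; exact: (bU A (subset_trans hA (s2 V U))).
Qed.

Lemma H1_reprK W F (a : H1 W F) : H1_class (H1_repr a) = a.
Proof. exact: reprK. Qed.

Lemma H1_class_repr W F (c : cocycle W F) : cohomologous (H1_repr (H1_class c)) c.
Proof. by apply/H1_classP; rewrite H1_reprK. Qed.

Lemma H1_map_class W F G (f : mor F G) (c : cocycle W F) :
  H1_map f (H1_class c) = H1_class (coc_map f c).
Proof. by apply/H1_classP/coc_map_cohom/H1_class_repr. Qed.

Lemma H1_res_class W W' (h : W' <=o W) F (c : cocycle W F) :
  H1_res h (H1_class c) = H1_class (coc_res h c).
Proof. by apply/H1_classP/coc_res_cohom/H1_class_repr. Qed.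

(** A primitive of f(c) - f(c') lifts term by term through f, and injectivity makes the lift a
    primitive of c - c'. *)
Lemma H1_map_inj W F G (f : mor F G) (a a' : H1 W F) : bij_over f W ->
  H1_map f a = H1_map f a' -> a = a'.
Proof.
move=> bf; rewrite -(H1_reprK a) -(H1_reprK a') !H1_map_class => /H1_classP.
move: (H1_repr a) (H1_repr a') => c c' [w [h [h' [b [hw hb]]]]].
apply/H1_classP; have bw x := bf (w x) (subset_trans (h x) (cov_sub (c := c) (x := x))).
pose b' x := sval (cid ((bw x).2 (b x))).
have b'P x : ap f (b' x) = b x := svalP (cid ((bw x).2 (b x))).
exists w, h, h', b'; split=> // x y V hx hy hc hc'.
apply: (bij_over_inj bf); first 
  exact: subset_trans hx (subset_trans (h x) (cov_sub (c := c) (x := x))).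
by rewrite !apB -!ap_res !b'P -(hb x y V hx hy hc hc').
Qed.

End Cohomology.

Section CohomologyPull.
Variables (k : fieldType) (Y X : ringed_space k) (p : morphism Y X).

Lemma H1_pull_class (W : opens X) (F : pmod Y) (c : cocycle W (push p F)) :
  H1_pull (H1_class c) = H1_class (coc_pull c).
Proof. by apply/H1_classP/coc_pull_cohom/H1_class_repr. Qed.

(* The edge map of the Leray spectral sequence is injective: if c_{py, pz} is the
   coboundary of b, the sections b_y - c_{x, py} glue over p^-1 (cov c x). *)
Lemma H1_pull_inj (W : opens X) (F : pmod Y) (a a' : H1 W (push p F)) :
  is_sheaf F -> H1_pull a = H1_pull a' -> a = a'.
Proof.
move=> shF; rewrite -(H1_reprK a) -(H1_reprK a') !H1_pull_class => /H1_classP.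
move: (H1_repr a) (H1_repr a') => c c' [w [h [h' [b [hw hb]]]]].
apply/H1_classP; pose u x := ocap (cov c x) (cov c' x).
have u1 x : u x <=o cov c x by move=> ? [].
have u2 x : u x <=o cov c' x by move=> ? [].
have uc x y : ocap (u x) (u y) <=o ocap (cov c x) (cov c y) by move=> s [[? _] [? _]].
have uc' x y : ocap (u x) (u y) <=o ocap (cov c' x) (cov c' y) by move=> s [[_ ?] [_ ?]].
pose d x y : F (pre p (ocap (u x) (u y))) :=
  res (push p F) (uc x y) (coc c x y) - res (push p F) (uc' x y) (coc c' x y).
have dP x y z V (hxy : V <=o pre p (ocap (u x) (u y))) (hyz : V <=o pre p (ocap (u y) (u z)))
    (hxz : V <=o pre p (ocap (u x) (u z))) :
    res F hxy (d x y) + res F hyz (d y z) = res F hxz (d x z).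
  (* [V] is an arbitrary open of Y. The law is proved over the triple intersection [T] on X, whose
     preimage contains [V]. *)
  pose T := ocap (u x) (ocap (u y) (u z)).
  have tAB : T <=o ocap (u x) (u y) by move=> s [? []].
  have tBC : T <=o ocap (u y) (u z) by move=> s [? []].
  have tAC : T <=o ocap (u x) (u z) by move=> s [? []].
  have VT : V <=o pre p T.
    by move=> s Vs; have [? ?] := hxy s Vs; have [? ?] := hyz s Vs.
  have E : res (push p F) tAB (d x y) + res (push p F) tBC (d y z)
      = res (push p F) tAC (d x z).
    rewrite !raddfB addrACA -opprD.
    rewrite (res_comp (uc x y) tAB (subset_trans tAB (uc x y)))
      (res_comp (uc' x y) tAB (subset_trans tAB (uc' x y))).
    rewrite (res_comp (uc y z) tBC (subset_trans tBC (uc y z)))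
      (res_comp (uc' y z) tBC (subset_trans tBC (uc' y z))).
    rewrite (res_comp (uc x z) tAC (subset_trans tAC (uc x z)))
      (res_comp (uc' x z) tAC (subset_trans tAC (uc' x z))).
    congr (_ - _); exact: coc_law.
  have := congr1 (res F VT) E; rewrite raddfD /= /push_res.
  rewrite (res_comp (pre_sub tAB) VT (subset_trans VT (pre_sub tAB))).
  rewrite (res_comp (pre_sub tBC) VT (subset_trans VT (pre_sub tBC))).
  rewrite (res_comp (pre_sub tAC) VT (subset_trans VT (pre_sub tAC))).
  by rewrite (res_irr hxy (subset_trans VT (pre_sub tAB))) 
    (res_irr hyz (subset_trans VT (pre_sub tBC)))
    (res_irr hxz (subset_trans VT (pre_sub tAC))).
have bP y z V (hy : V <=o w y) (hz : V <=o w z) (hd : V <=o pre p (ocap (u (p y)) (u (p z)))) :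
    res F hd (d (p y) (p z)) = res F hz (b z) - res F hy (b y).
  have g1 := subset_trans hd (pre_sub (uc (p y) (p z))).
  have g2 := subset_trans hd (pre_sub (uc' (p y) (p z))).
  rewrite -(hb y z V hy hz g1 g2) raddfB /= /push_res.
  rewrite (res_comp (pre_sub (uc _ _)) hd g1) (res_comp (pre_sub (uc' _ _)) hd g2).
  by congr (_ - _); apply/esym; apply: res_comp.
have dE x y : d x y = res (push p F) (uc x y) (coc c x y) -
  res (push p F) (uc' x y) (coc c' x y) by [].
clearbody d.
have ex x : exists s : F (pre p (u x)), forall y V (hy : V <=o w y) (hx : V <=o pre p (u x))
    (hd : V <=o pre p (ocap (u x) (u (p y)))),
    res F hx s = res F hy (b y) - res F hd (d x (p y)).
  pose Q V (hx : V <=o pre p (u x)) (s : F V) :=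
    exists y (hy : V <=o w y) (hd : V <=o pre p (ocap (u x) (u (p y)))),
      s = res F hy (b y) - res F hd (d x (p y)).
  have [||s sP] := @sheaf_glue _ _ F (pre p (u x)) Q shF.
  - move=> y uy; have Wy : oset (pre p W) y by case: uy => /(@cov_sub _ _ _ _ c).
    have hx : ocap (w y) (pre p (u x)) <=o pre p (u x) by move=> ? [].
    have hy : ocap (w y) (pre p (u x)) <=o w y by move=> ? [].
    have hd : ocap (w y) (pre p (u x)) <=o pre p (ocap (u x) (u (p y))).
      move=> s [ws us]; split=> //; split; [exact: (h y s ws)|exact: (h' y s ws)].
    exists (ocap (w y) (pre p (u x))), hx, (res F hy (b y) - res F hd (d x (p y))).
    by split; [split=> //; exact: (hw y Wy)|exists y, hy, hd].
  - move=> V V' hx hx' s s' T t t' [y [hy [hd ->]]] [z [hz [hd' ->]]].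
    rewrite !raddfB (res_comp hy t (subset_trans t hy)) (res_comp hz t' (subset_trans t' hz)).
    rewrite (res_comp hd t (subset_trans t hd)) (res_comp hd' t' (subset_trans t' hd')).
    have hyz : T <=o pre p (ocap (u (p y)) (u (p z))).
      by move=> r Tr; case: (hd r (t r Tr)) => _ ?; case: (hd' r (t' r Tr)).
    have := bP y z T (subset_trans t hy) (subset_trans t' hz) hyz.
    have := dP x (p y) (p z) T (subset_trans t hd) hyz (subset_trans t' hd').
    move=> <- /(congr1 (fun q => q + res F (subset_trans t hy) (b y))).
    rewrite subrK => <-.
    by rewrite [_ + res F (subset_trans t hy) _]addrC opprD addrACA subrr addr0.
  by exists s => y V hy hx hd; apply: sP; exists y, hy, hd.
pose s x := sval (cid (ex x)); have sP x := svalP (cid (ex x)).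
exists u, u1, u2, s; split=> [x Wx|x y V hx hy hc hc'].
  by split; [apply: (@cov_in _ _ _ _ c)|apply: (@cov_in _ _ _ _ c')].
have hu : V <=o ocap (u x) (u y) by subo.
transitivity (res (push p F) hu (d x y)).
  by rewrite dE raddfB (res_comp (uc x y) hu hc) (res_comp (uc' x y) hu hc').
rewrite /= /push_res.
(* Near z the sections [s x] and [s y] are b_z - d_{x,pz} and b_z - d_{y,pz}; in their difference
   b_z cancels, and the cocycle law leaves d_{x,y}. *)
apply: sheaf_sep => // z Vz.
have Wz : oset (pre p W) z by have /hx[/(@cov_sub _ _ _ _ c)] := Vz.
have g : ocap (w z) (pre p V) <=o pre p V by move=> ? [].
have gz : ocap (w z) (pre p V) <=o w z by move=> ? [].
have gx : ocap (w z) (pre p V) <=o pre p (u x) by move=> r [_ /hx].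
have gy : ocap (w z) (pre p V) <=o pre p (u y) by move=> r [_ /hy].
have gu : ocap (w z) (pre p V) <=o pre p (ocap (u x) (u y)) by move=> r [_ /hu].
have gxz : ocap (w z) (pre p V) <=o pre p (ocap (u x) (u (p z))).
  by move=> r [wr /hx ur]; split=> //; split; [exact: (h z r wr)|exact: (h' z r wr)].
have gyz : ocap (w z) (pre p V) <=o pre p (ocap (u y) (u (p z))).
  by move=> r [wr /hy ur]; split=> //; split; [exact: (h z r wr)|exact: (h' z r wr)].
exists _, g; split; first by split=> //; exact: (hw z Wz).
rewrite raddfB (res_comp _ g gu) (res_comp _ g gx) (res_comp _ g gy).
rewrite (sP x z _ gz gx gxz) (sP y z _ gz gy gyz) opprB addrC addrA subrK.
by rewrite -(dP x y (p z) _ gu gyz gxz) addrK.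
Qed.

End CohomologyPull.

(** * Connections and the Atiyah class *)

Section Connections.
Variables (k : fieldType) (X : ringed_space k) (Om : cotangent X).
Implicit Types (U V W : opens X) (F : pmod X).

(* An O-linear lift of the identity along J^1(F) -> F is e |-> (e, D e) with D a
   connection on F. *)
Definition is_connection F U (sg : homs F (jet Om F) U) : Prop :=
  forall V (h : V <=o U) (e : F V), (sg V h e : jet_sec Om F V).1 = e.

Definition conn F U (sg : homs F (jet Om F) U) V (h : V <=o U) (e : F V) :
  tensor Om F V := (sg V h e : jet_sec Om F V).2.

Lemma tensBr F U (w : Om U) (e e' : F U) : tens w (e - e') = tens w e - tens w e'.
Proof. by rewrite tensDr -scaleN1r tensZr scaleN1r. Qed.

Lemma tensBl F U (w w' : Om U) (e : F U) : tens (w - w') e = tens w e - tens w' e.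
Proof. by rewrite tensDl -scaleN1r tensZl scaleN1r. Qed.

Lemma connD F U (sg : homs F (jet Om F) U) V (h : V <=o U) (e e' : F V) :
  conn sg h (e + e') = conn sg h e + conn sg h e'.
Proof. by rewrite /conn homsD. Qed.

Lemma connZ F U (sg : homs F (jet Om F) U) V (h : V <=o U) a (e : F V) :
  is_connection sg ->
  conn sg h (a *: e) = a *: conn sg h e + tens (dif Om a) e.
Proof. by move=> cs; rewrite /conn homsZ /= cs. Qed.

Lemma conn_res F U (sg : homs F (jet Om F) U) V V' (h : V <=o U) (h' : V' <=o V)
    (h'' : V' <=o U) (e : F V) :
  res (tensor Om F) h' (conn sg h e) = conn sg h'' (res F h' e).
Proof. by rewrite /conn -(hom_nat sg h h' h''). Qed.

Lemma conn_hom_res F U U' (h : U' <=o U) (sg : homs F (jet Om F) U) :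
  is_connection sg -> is_connection (hom_res h sg).
Proof. by move=> cs V hV e; apply: cs. Qed.

Lemma jet_lin F V a (e e' : F V) (w w' : tensor Om F V) :
  (a *: ((e, w) : jet Om F V) + ((e', w') : jet Om F V) : jet_sec Om F V)
    = (a *: e + e', a *: w + tens (dif Om a) e + w').
Proof. by []. Qed.

Lemma build_connection F U
    (D : forall V, V <=o U -> F V -> tensor Om F V) :
  (forall V (h : V <=o U) a (e e' : F V),
     D V h (a *: e + e') = a *: D V h e + tens (dif Om a) e + D V h e') ->
  (forall V V' (h : V <=o U) (h' : V' <=o V) (h'' : V' <=o U) (e : F V),
     res (tensor Om F) h' (D V h e) = D V' h'' (res F h' e)) ->
  exists2 sg : homs F (jet Om F) U, is_connection sg &
    forall V (h : V <=o U) e, conn sg h e = D V h e.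
Proof.
move=> Dl Dn; pose f V (h : V <=o U) (e : F V) : jet Om F V := (e, D V h e).
have fl V (h : V <=o U) a (e e' : F V) : f V h (a *: e + e') = a *: f V h e + f V h e'.
  by rewrite /f jet_lin Dl.
have fn V V' (h : V <=o U) (h' : V' <=o V) (h'' : V' <=o U) (e : F V) :
    res (jet Om F) h' (f V h e) = f V' h'' (res F h' e).
  by rewrite /f -(Dn V V' h h' h'').
by exists (Homs fl fn).
Qed.

(** The connection for which the frame is flat: e_i is lifted to (e_i, 0). *)
Lemma frame_connection F U r (e : 'I_r -> F U) : is_frame e ->
  exists sg : homs F (jet Om F) U, is_connection sg.
Proof.
move=> fe; have [sg sgP] := frame_hom (N := jet Om F) (fun i => (e i, 0) : jet_sec Om F U) fe.
exists sg => V h m; have [c [-> _]] := fe V h m; rewrite sgP.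
pose fst1 (x : jet Om F V) : F V := (x : jet_sec Om F V).1.
rewrite -[LHS]/(fst1 _) (big_morph fst1 (id1 := 0) (op1 := +%R)) //.
Qed.

(** Connections form a torsor under Omega (x) End(F); this is the translation by the scalar element
    -w (x) id. *)
Lemma scale_connection F U (sg : homs F (jet Om F) U) (w : Om U) : is_connection sg ->
  exists2 sg' : homs F (jet Om F) U, is_connection sg' &
    forall V (h : V <=o U) e, conn sg' h e = conn sg h e - tens (res Om h w) e.
Proof.
move=> cs; apply: build_connection => [V h a e e'|V V' h h' h'' e].
  rewrite connD connZ // tensDr tensZr scalerBr opprD addrACA.
  by congr (_ + _); rewrite addrAC.
rewrite raddfB /= (conn_res sg h h' h''); congr (_ - _).
by rewrite -(res_comp h h' h''); apply: res_tens.
Qed.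

(** By naturality in t, the value on a smaller open V' is that of the restricted t on V' itself.
    This matches [is_atiyah_cocycle], which tests t and e over one and the same open. *)
Lemma tensor_end_eq F W (c c' : tensor Om (EndM F) W) :
  (forall V (h : V <=o W) (t : dual Om V) e,
     c V h t V (subo_refl V) e = c' V h t V (subo_refl V) e) -> c = c'.
Proof.
move=> E; apply: homs_eq => V h t; apply: homs_eq => V' h' e.
have R (s : tensor Om (EndM F) W) :
    s V h t V' h' e = s V' (subset_trans h' h) (res (dual Om) h' t) V' (subo_refl V') e.
  rewrite -(hom_nat s h h' (subset_trans h' h) t) /=.
  exact: homs_irr.
by rewrite !R E.
Qed.

Lemma tens_idE F U (w : Om U) V (h : V <=o U) (t : dual Om V) (e : F V) :
  tens w (hom_id F U) V h t V (subo_refl V) e =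
  t V (subo_refl V) (res Om h w) *: e.
Proof.
rewrite tensE /=; congr (_ *: _); exact: resO_id.
Qed.

(** The Leibniz terms cancel, so the difference is O-linear from F to Omega (x) F. Exchanging the
    arguments e and t turns it into a section of Hom(Omega^dual, End F). *)
Lemma conn_diff F W (sg sg' : homs F (jet Om F) W) :
  is_connection sg -> is_connection sg' ->
  exists c : tensor Om (EndM F) W, forall V (h : V <=o W) (t : dual Om V) (e : F V),
    c V h t V (subo_refl V) e = (conn sg' h e - conn sg h e) V (subo_refl V) t.
Proof.
move=> cs cs'; pose d V (h : V <=o W) e := conn sg' h e - conn sg h e.
have dl V (h : V <=o W) a e e' : d V h (a *: e + e') = a *: d V h e + d V h e'.
  rewrite /d !connD !connZ // scalerBr opprD addrACA; congr (_ + _).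
  by rewrite opprD addrACA subrr addr0.
have dn V V' (h : V <=o W) (h' : V' <=o V) (h'' : V' <=o W) e :
    res (tensor Om F) h' (d V h e) = d V' h'' (res F h' e).
  by rewrite /d raddfB /= !(conn_res _ h h' h'').
pose f1 V (h : V <=o W) (t : dual Om V) V1 (h1 : V1 <=o V) (e : F V1) :=
  d V1 (subset_trans h1 h) e V1 (subo_refl V1) (res (dual Om) h1 t).
have f1l V h t V1 (h1 : V1 <=o V) a e e' : @f1 V h t V1 h1 (a *: e + e') =
    a *: @f1 V h t V1 h1 e + @f1 V h t V1 h1 e'.
  by rewrite /f1 dl /= resO_id.
have f1n V h t V1 V2 (h1 : V1 <=o V) (h2 : V2 <=o V1) (h3 : V2 <=o V) (e : F V1) :
    res F h2 (@f1 V h t V1 h1 e) = @f1 V h t V2 h3 (res F h2 e).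
  rewrite /f1 -(dn _ _ (subset_trans h1 h) h2 (subset_trans h3 h)).
  rewrite (hom_nat (d V1 _ e) _ h2 h2) (res_comp h1 h2 h3).
  exact: (homs_irr (d V1 (subset_trans h1 h) e)).
pose f2 V (h : V <=o W) (t : dual Om V) : EndM F V := Homs (@f1l V h t) (@f1n V h t).
have f2l V (h : V <=o W) a t t' : f2 V h (a *: t + t') = a *: f2 V h t + f2 V h t'.
  apply: homs_eq => V1 h1 e /=; rewrite /f1.
  by rewrite raddfD resZ hom_lin.
have f2n V V' (h : V <=o W) (h' : V' <=o V) (h'' : V' <=o W) (t : dual Om V) :
    res (EndM F) h' (f2 V h t) = f2 V' h'' (res (dual Om) h' t).
  apply: homs_eq => V1 h1 e /=; rewrite /f1.
  rewrite (res_comp h' h1 (subset_trans h1 h')).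
  by rewrite (Prop_irrelevance (subset_trans (subset_trans h1 h') h) (subset_trans h1 h'')).
exists (Homs f2l f2n) => V h t e; rewrite /= /f1 res_id.
by rewrite (Prop_irrelevance (subset_trans (subo_refl V) h) h).
Qed.

Lemma atiyah_cocycleP W F (c : cocycle W (tensor Om (EndM F))) :
  is_atiyah_cocycle c <->
  exists sg : forall x, homs F (jet Om F) (cov c x),
    (forall x, is_connection (sg x)) /\
    forall x y V (h : V <=o ocap (cov c x) (cov c y))
       (hx : V <=o cov c x) (hy : V <=o cov c y) (t : dual Om V) (e : F V),
       coc c x y V h t V (subo_refl V) e
       = (conn (sg y) hy e - conn (sg x) hx e) V (subo_refl V) t.
Proof. by []. Qed.

(** On the common refinement the differences sg_x - sg'_x of the two families of connections are a
    primitive of c - c'. *)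
Lemma atiyah_cocycle_cohom W F (c c' : cocycle W (tensor Om (EndM F))) :
  is_atiyah_cocycle c -> is_atiyah_cocycle c' -> cohomologous c c'.
Proof.
move=> /atiyah_cocycleP[sg [cs E]] /atiyah_cocycleP[sg' [cs' E']].
pose w x := ocap (cov c x) (cov c' x).
have h x : w x <=o cov c x by move=> ? [].
have h' x : w x <=o cov c' x by move=> ? [].
have ex x := conn_diff (conn_hom_res (h' x) (cs' x)) (conn_hom_res (h x) (cs x)).
pose b x := sval (cid (ex x)); have bP x := svalP (cid (ex x)).
exists w, h, h', b; split=> [x Wx|x y V hx hy hc hc'].
  by split; [apply: (@cov_in _ _ _ _ c)|apply: (@cov_in _ _ _ _ c')].
apply: tensor_end_eq => V1 h1 t e.
have cx := subset_trans (subset_trans h1 hx) (h x).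
have cy := subset_trans (subset_trans h1 hy) (h y).
have cx' := subset_trans (subset_trans h1 hx) (h' x).
have cy' := subset_trans (subset_trans h1 hy) (h' y).
have /= := E x y V1 (subset_trans h1 hc) cx cy t e.
have /= := E' x y V1 (subset_trans h1 hc') cx' cy' t e.
have /= := bP x V1 (subset_trans h1 hx) t e.
have /= := bP y V1 (subset_trans h1 hy) t e.
rewrite -/(b x) -/(b y) => -> -> -> ->.
rewrite /conn /= !(homs_irr (sg _) _ cx) !(homs_irr (sg _) _ cy).
rewrite !(homs_irr (sg' _) _ cx') !(homs_irr (sg' _) _ cy').
by rewrite !opprB addrACA [RHS]addrACA; congr (_ + _); rewrite addrC.
Qed.

(** The set behind [xget] is then the singleton of this class, so At(F) may be computed from any
    family of local connections. *)
Lemma atiyah_class W F (c : cocycle W (tensor Om (EndM F))) :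
  is_atiyah_cocycle c -> atiyah Om W F = H1_class c.
Proof.
move=> ac; apply: xget_unique; first by exists c.
by move=> _ [c' [ac' ->]]; apply/H1_classP; apply: atiyah_cocycle_cohom.
Qed.

Lemma atiyah_cocycle_res W W' (h : W' <=o W) F (c : cocycle W (tensor Om (EndM F))) :
  is_atiyah_cocycle c -> is_atiyah_cocycle (coc_res h c).
Proof.
move=> /atiyah_cocycleP[sg [cs E]]; apply/atiyah_cocycleP.
have s x : ocap (cov c x) W' <=o cov c x by move=> ? [].
exists (fun x => hom_res (s x) (sg x)); split=> [x|x y V hc hx hy t e /=].
  exact: conn_hom_res.
rewrite (E x y V _ (subset_trans hx (s x)) (subset_trans hy (s y))) //.
Qed.

(** The index type is arbitrary because the opens p^-1 U_x of Y will be indexed by points of X, not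
    of Y. *)
Lemma conn_diffs F (I : Type) (u : I -> opens X)
    (sg : forall i, homs F (jet Om F) (u i)) : (forall i, is_connection (sg i)) ->
  exists d : forall i j, tensor Om (EndM F) (ocap (u i) (u j)),
    (forall i j V (h : V <=o ocap (u i) (u j)) (hi : V <=o u i) (hj : V <=o u j) t e,
      d i j V h t V (subo_refl V) e = (conn (sg j) hj e - conn (sg i) hi e) V (subo_refl V) t)
    /\ (forall i j l V (hij : V <=o ocap (u i) (u j)) (hjl : V <=o ocap (u j) (u l))
      (hil : V <=o ocap (u i) (u l)),
      res (tensor Om (EndM F)) hij (d i j) + res (tensor Om (EndM F)) hjl (d j l)
      = res (tensor Om (EndM F)) hil (d i l)).
Proof.
move=> cs.
have s1 i j : ocap (u i) (u j) <=o u i by move=> ? [].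
have s2 i j : ocap (u i) (u j) <=o u j by move=> ? [].
have exd i j := conn_diff (conn_hom_res (s1 i j) (cs i)) (conn_hom_res (s2 i j) (cs j)).
pose d i j := sval (cid (exd i j)).
have dP i j V (h : V <=o ocap (u i) (u j)) (hi : V <=o u i) (hj : V <=o u j) t e :
   d i j V h t V (subo_refl V) e = (conn (sg j) hj e - conn (sg i) hi e) V (subo_refl V) t.
  rewrite (svalP (cid (exd i j))) /conn /=.
  by rewrite (homs_irr (sg i) (subset_trans h (s1 i j)) hi)
    (homs_irr (sg j) (subset_trans h (s2 i j)) hj).
clearbody d; exists d; split=> // i j l V hij hjl hil.
apply: tensor_end_eq => V1 h1 t e.
have hi := subset_trans (subset_trans h1 hij) (s1 i j).
have hj := subset_trans (subset_trans h1 hij) (s2 i j).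
have hl := subset_trans (subset_trans h1 hjl) (s2 j l).
have /= := dP i j V1 (subset_trans h1 hij) hi hj t e.
have /= := dP j l V1 (subset_trans h1 hjl) hj hl t e.
have /= := dP i l V1 (subset_trans h1 hil) hi hl t e.
by move=> -> -> ->; rewrite [LHS]addrC addrA subrK.
Qed.

Lemma atiyah_cocycle_exists F r : locally_free F r ->
  exists c : cocycle (otop X) (tensor Om (EndM F)), is_atiyah_cocycle c.
Proof.
move=> lf.
have ex x : exists U : opens X, oset U x /\ exists sg : homs F (jet Om F) U, is_connection sg.
  by have [U [e [Ux fe]]] := lf x; exists U; split=> //; apply: frame_connection fe.
pose u x := sval (cid (ex x)).
have ux x : oset (u x) x := (svalP (cid (ex x))).1.
have [d [dP law]] := conn_diffs (u := u) (fun x => svalP (cid (svalP (cid (ex x))).2)).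
have ut x : u x <=o otop X by [].
exists (@Cocycle _ _ (otop X) _ u ut (fun x _ => ux x) d law).
by apply/atiyah_cocycleP; eexists; split; last exact: dP; move=> x; exact: svalP.
Qed.

End Connections.

(** * Connections on line bundles and their differences as 1-forms *)

Section LineBundles.
Variables (k : fieldType) (X : ringed_space k) (Om : cotangent X).
Implicit Types (U V W : opens X) (F L : pmod X).

Lemma locally_free_generator F (x : X) : locally_free F 1 ->
  exists U (m : F U), oset U x /\ is_generator m.
Proof.
move=> lf; have [U [e [Ux fe]]] := lf x; exists U, (e ord0); split=> //.
have E : (fun=> e ord0) = e.
  by apply: functional_extensionality_dep => i; rewrite (ord1 i).
by rewrite /is_generator E.
Qed.

(** Pairing with the coordinate dual to w leaves a l = 0, and l is a generator. *)
Lemma tens_generator_eq0 F U (w : Om U) (l : F U) V (h : V <=o U) (a : OO X V) :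
  is_generator w -> is_generator l ->
  (forall V' (h' : V' <=o V) (t : dual Om V'),
    (t V' (subo_refl V') (res Om h' (a *: res Om h w)) : OO X V') *:
     res F (subset_trans h' h) l = 0) -> a = 0.
Proof.
move=> gw gl E; have [t0 t0P] := dual_generator gw.
have := E V (subo_refl V) (res (dual Om) h t0).
rewrite res_id /= (homs_irr t0 _ h) t0P => E0.
by have /generatorP[_ fr] := gl; apply: fr E0.
Qed.

Lemma scalar_endE L U (w : Om U) : ap (scalar_end Om L) w = tens w (hom_id L U).
Proof. by []. Qed.

(** Where L has a generator l, an endomorphism f is multiplication by the coefficient a of f(l)
    along l, so w (x) f = (a w) (x) id. *)
Lemma scalar_end_bij L W : is_sheaf (Omod X) -> locally_free Om 1 ->
  line_bundle L -> bij_over (scalar_end Om L) W.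
Proof.
move=> shO lO [shL lL]; apply: bij_over_local; first exact: Om_sheaf.
  exact/Hom_sheaf/Hom_sheaf.
move=> x _; have [U1 [w1 [U1x gw1]]] := locally_free_generator x lO.
have [U2 [l2 [U2x gl2]]] := locally_free_generator x lL.
pose U := ocap U1 U2.
have s1 : U <=o U1 by move=> ? [].
have s2 : U <=o U2 by move=> ? [].
have gw := generator_res s1 gw1; have gl := generator_res s2 gl2.
move: (res Om s1 w1) (res L s2 l2) gw gl => w l gw gl.
exists U; split=> // V hV; split=> [m m0|s].
  have [a Ea] := generator_span hV m gw.
  rewrite Ea (tens_generator_eq0 (h := hV) gw gl (a := a)) ?scale0r // => V' h' t.
  have /(congr1 (fun f : tensor Om (EndM L) V =>
    f V' h' t V' (subo_refl V') (res L (subset_trans h' hV) l))) := m0.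
  by rewrite scalar_endE tens_idE -Ea.
have [t0 t0P] := dual_generator gw.
rewrite (tensor_decomp hV s gw t0P); set f := s V _ _.
have [a Ea] := generator_span (subo_refl V) (f V (subo_refl V) (res L hV l)) (generator_res hV gl).
exists (a *: res Om hV w); rewrite scalar_endE tensZl -tensZr; congr tens.
apply: homs_eq => V' h' e /=.
have [b ->] := generator_span (subset_trans h' hV) e gl.
rewrite homsZ -(res_comp hV h' (subset_trans h' hV)) -(hom_nat f (subo_refl V) h' h').
by rewrite Ea !resZ !(res_id, res_comp _ _ h') // !scalerA mulrC.
Qed.

(** Differences of connections lie in Omega (x) End(L). As [scalar_end] is bijective they are
    1-forms, and the cocycle law passes to these by injectivity. *)
Lemma line_conn_diffs L (I : Type) (u : I -> opens X)
    (sg : forall i, homs L (jet Om L) (u i)) :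
  is_sheaf (Omod X) -> locally_free Om 1 -> line_bundle L ->
  (forall i, is_connection (sg i)) ->
  exists d : forall i j, Om (ocap (u i) (u j)),
    (forall i j V (h : V <=o ocap (u i) (u j)) (hi : V <=o u i) (hj : V <=o u j) (e : L V),
      conn (sg j) hj e - conn (sg i) hi e = tens (res Om h (d i j)) e)
    /\ (forall i j l V (hij : V <=o ocap (u i) (u j)) (hjl : V <=o ocap (u j) (u l))
      (hil : V <=o ocap (u i) (u l)),
      res Om hij (d i j) + res Om hjl (d j l) = res Om hil (d i l)).
Proof.
move=> shO lO lL cs; have [c [cP law]] := conn_diffs cs.
have bij W := scalar_end_bij (W := W) shO lO lL.
have sur i j := (bij _ _ (subo_refl (ocap (u i) (u j)))).2 (c i j).
have [w dP] : exists w : forall i j, Om (ocap (u i) (u j)),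
    forall i j, ap (scalar_end Om L) (w i j) = c i j.
  by exists (fun i j => sval (cid (sur i j))) => i j; exact: (svalP (cid (sur i j))).
exists w; split=> [i j V h hi hj e|i j l V hij hjl hil].
  apply: homs_eq => V' h' t; rewrite tensE.
  have := cP i j V' (subset_trans h' h) (subset_trans h' hi) (subset_trans h' hj) t (res L h' e).
  rewrite -(conn_res _ hi h') -(conn_res _ hj h') -raddfB /=.
  rewrite -dP scalar_endE tens_idE (res_comp h h' (subset_trans h' h)) => ->.
  by rewrite (Prop_irrelevance (subset_trans (subo_refl V') h') h').
apply: (bij_over_inj (bij V) (subo_refl V)).
by rewrite apD -!ap_res !dP law.
Qed.

Lemma conn_eq F W (sg sg' : homs F (jet Om F) W) :
  is_connection sg -> is_connection sg' ->
  (forall V (h : V <=o W) e, conn sg h e = conn sg' h e) -> sg = sg'.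
Proof.
move=> cs cs' E; apply: homs_eq => V h e.
have := E V h e; have := cs V h e; have := cs' V h e; rewrite /conn.
by case: (sg V h e) => a b; case: (sg' V h e) => a' b' /= -> -> ->.
Qed.

(** Local connections differ by a cocycle of 1-forms, which is the coboundary of some b because W is
    affine and Omega has a generator there. Subtracting b_x from the connection at x makes all of
    them agree. *)
Lemma affine_connection L W (eta : Om W) :
  is_sheaf (Omod X) -> locally_free Om 1 -> line_bundle L -> affine W ->
  is_generator eta -> exists sg : homs L (jet Om L) W, is_connection sg.
Proof.
move=> shO lO lL aW geta.
have ex x : exists U : opens X, oset U x /\ exists sg : homs L (jet Om L) U, is_connection sg.
  have [U [e [Ux fe]]] := locally_free_generator x lL.2.
  by exists U; split=> //; apply: frame_connection fe.
pose u x := ocap (sval (cid (ex x))) W.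
have su x : u x <=o sval (cid (ex x)) by move=> ? [].
have uW x : u x <=o W by move=> ? [].
have ux x : oset W x -> oset (u x) x by split=> //; exact: (svalP (cid (ex x))).1.
have [sg cs] : exists sg : forall x, homs L (jet Om L) (u x), forall x, is_connection (sg x).
  exists (fun x => hom_res (su x) (sval (cid (svalP (cid (ex x))).2))) => x.
  exact: conn_hom_res (svalP (cid (svalP (cid (ex x))).2)).
have [d [dP law]] := line_conn_diffs shO lO lL cs.
have [b bP] := affine_coboundary (Cocycle uW ux law) shO (@Om_sheaf _ _ Om) aW geta.
have ex' x := scale_connection (b x) (cs x).
pose sg' x := s2val (cid2 (ex' x)).
have cs' x : is_connection (sg' x) := s2valP (cid2 (ex' x)).
have sgE x V (h : V <=o u x) e :
    conn (sg' x) h e = conn (sg x) h e - tens (res Om h (b x)) e.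
  exact: (s2valP' (cid2 (ex' x))).
clearbody sg'; have agr x y V (hx : V <=o u x) (hy : V <=o u y) :
    hom_res hx (sg' x) = hom_res hy (sg' y).
  apply: conn_eq; [exact: conn_hom_res|exact: conn_hom_res|move=> V' h e].
  have gx := subset_trans h hx; have gy := subset_trans h hy.
  have gc : V' <=o ocap (u x) (u y) by move=> ? ?; split; [apply: gx|apply: gy].
  transitivity (conn (sg' x) gx e); first
    by rewrite /conn /= (homs_irr (sg' x) (subset_trans h hx) gx).
  transitivity (conn (sg' y) gy e); last
    by rewrite /conn /= (homs_irr (sg' y) (subset_trans h hy) gy).
  rewrite !sgE.
  have /= E := bP x y V' gx gy gc.
  have := dP x y V' gc gx gy e; rewrite E => /(congr1 (fun z => z + conn (sg x) gx e)).
  rewrite subrK => ->.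
  rewrite tensBl.
  by rewrite [RHS]addrAC [_ - _ - _]addrAC subrr sub0r addrC.
(* The connections are glued as sections of the sheaf Hom(L, J^1(L)); that the result still lifts
   the identity is checked locally. *)
have shJ := @Hom_sheaf _ _ L (jet Om L) (@jet_sheaf _ _ Om L lL.1).
have [sg0 [sgP _]] := shJ W X u uW sg' (fun x Wx => ex_intro (fun i => oset (u i) x) x (ux x Wx))
  (fun x y V hx hy => agr x y V hx hy).
exists sg0 => V h e; apply: (sheaf_sep lL.1) => x Vx.
have g1 : ocap V (u x) <=o V by move=> ? [].
have g2 : ocap V (u x) <=o u x by move=> ? [].
exists (ocap V (u x)), g1; split; first by split=> //; apply/ux/h.
transitivity (sg0 _ (subset_trans g1 h) (res L g1 e) : jet_sec Om L _).1.
  by rewrite -(hom_nat sg0 h g1).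
rewrite -[RHS](cs' x _ g2) -sgP /=.
by rewrite (homs_irr sg0 (subset_trans g1 h) (subset_trans g2 (uW x))).
Qed.

End LineBundles.

(** * Differentials over the etale locus *)

Section DifferentialsSpan.
Variables (k : fieldType) (X : ringed_space k) (Om : cotangent X) (U : opens X).

Section Submodule.
Variables (N : set (Om U)) (N0 : N 0).
Hypothesis NL : forall a m n, N m -> N n -> N (a *: m + n).

Definition submod_pred : {pred Om U} := fun m => `[< N m >].

Fact submod_pred_closed : submod_closed submod_pred.
Proof.
split=> [|a m n /asboolP Nm /asboolP Nn]; first exact/asboolP.
by apply/asboolP; apply: NL.
Qed.
HB.instance Definition _ := GRing.isSubmodClosed.Build _ _ submod_pred submod_pred_closed.

(** [N] as a module in its own right, so that it can be a target in the universal property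
    [dif_univ]. *)
Record submod_type := Submod { submod_val :> Om U; _ : submod_val \in submod_pred }.
HB.instance Definition _ := [isSub for submod_val].
HB.instance Definition _ := [Choice of submod_type by <:].
HB.instance Definition _ := [SubChoice_isSubLmodule of submod_type by <:].

(* The universal property applied to N and to Om U: the inclusion composed with
   the linear map Om U -> N induced by d is the identity. *)
Lemma dif_span : affine U -> (forall f, N (dif Om f)) -> forall m, N m.
Proof.
move=> aU Nd.
have Nd' f : dif Om f \in submod_pred by apply/asboolP.
pose D f : submod_type := Submod (Nd' f).
have [dD dM dc] := dif_der Om U.
have derD : derivation D.
  split=> [a b|a b|c]; apply: val_inj => /=; rewrite ?dD ?dM ?dc //.
have [u [uD _]] := dif_univ Om aU derD.
rewrite /= in uD.
have [v [_ vU]] := dif_univ Om aU (dif_der Om U).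
pose iu : {linear Om U -> Om U} := \val \o u.
have E1 : v = iu by apply: vU => f; rewrite /= uD.
have E2 : v = idfun by apply: vU => f.
move=> m; apply/asboolP; rewrite -[m]/((idfun : {linear Om U -> Om U}) m) -E2 E1 /=.
exact: valP (u m).
Qed.

End Submodule.
End DifferentialsSpan.

Section NzRing.
Variables (A B : comPzRingType) (hA : (1 : A) != 0) (hB : (1 : B) != 0).
Variable f : {rmorphism A -> B}.
(** Polynomials and matrices are taken over nonzero rings. [nzring] leaves the carrier and
    operations as they are, so [f] serves unchanged. *)
Definition nzmorph : {rmorphism nzring hA -> nzring hB} := f.
End NzRing.

(** * Evaluation of polynomials at the tautological section *)

Section ChartEval.
Variables (k : fieldType) (X Y : ringed_space k) (Om : cotangent X) (E : pmod X).
Variables (theta : mor E (tensor Om E)) (p : morphism Y X).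
Variables (lam : mor (dual Om) (push p (Omod Y))) (r : nat) (c : chart theta r).
Local Notation A := (nzring (ch_nz c)).
Local Notation U := (ch_open c).
Local Notation T := (taut lam (ch_coord c)).
Local Notation ev := (ch_eval lam).
Implicit Types q : {poly A}.

Let pl : {rmorphism A -> OO Y (pre p U)} := pull p U.

Lemma ch_eval_widen n q : (size q <= n)%N ->
  ev q = \sum_(i < n) pl q`_i * T ^+ i.
Proof.
move=> qn; rewrite /ch_eval (big_ord_widen n (fun i => pl q`_i * T ^+ i) qn).
rewrite big_mkcond /=; apply: eq_bigr => i _; case: ltnP => // qi.
by rewrite nth_default // rmorph0 mul0r.
Qed.

Lemma ch_evalD q q' : ev (q + q') = ev q + ev q'.
Proof.
pose n := maxn (size q) (size q').
rewrite (@ch_eval_widen n) ?size_polyD // (@ch_eval_widen n q) ?leq_maxl //.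
rewrite (@ch_eval_widen n q') ?leq_maxr // -big_split; apply: eq_bigr => i _ /=.
by rewrite (coefD q q' i) rmorphD mulrDl.
Qed.

Lemma ch_evalC a : ev a%:P = pl a.
Proof.
by rewrite (@ch_eval_widen 1) ?size_polyC ?leq_b1 // big_ord1 (coefC a 0) eqxx expr0 mulr1.
Qed.

Lemma ch_evalCM a q : ev (a%:P * q) = pl a * ev q.
Proof.
rewrite (@ch_eval_widen (size q)); last by rewrite mul_polyC size_scale_leq.
rewrite /ch_eval mulr_sumr; apply: eq_bigr => i _.
by rewrite (coefCM a q i) rmorphM mulrA.
Qed.

Lemma ch_evalMX q : ev (q * 'X) = ev q * T.
Proof.
rewrite (@ch_eval_widen (size q).+1); last first.
  by have [->|q0] := eqVneq q 0; rewrite ?mul0r ?size_poly0 // size_mulX.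
rewrite big_ord_recl (coefMX q 0) eqxx rmorph0 mul0r add0r /ch_eval mulr_suml.
by apply: eq_bigr => i _; rewrite (coefMX q i.+1) /= exprSr mulrA.
Qed.

Lemma ch_evalM q q' : ev (q * q') = ev q * ev q'.
Proof.
elim/poly_ind: q => [|q a IH]; first by rewrite mul0r -(polyC0 A) ch_evalC rmorph0 mul0r.
rewrite mulrDl !ch_evalD mulrDl ch_evalCM ch_evalC ch_evalMX; congr (_ + _).
by rewrite -mulrA ['X * _]mulrC mulrA ch_evalMX IH mulrAC.
Qed.

(** The chain rule d(q(T)) = q'(T) dT modulo a submodule [N] that contains the differentials pulled
    back from X, by induction on q. *)
Lemma ch_eval_dif (OmY : cotangent Y) V (h : V <=o pre p U) (N : set (OmY V)) q :
  N 0 -> (forall a m n, N m -> N n -> N (a *: m + n)) ->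
  (forall a, N (dif OmY (resO h (pull p U a)))) ->
  N (dif OmY (resO h (ev q)) - resO h (ev q^`()) *: dif OmY (resO h T)).
Proof.
move=> N0 NL Na; have [dD dM _] := dif_der OmY V.
elim/poly_ind: q => [|q a IH].
  rewrite deriv0 -(polyC0 A) ch_evalC rmorph0 rmorph0 scale0r subr0.
  by rewrite -(rmorph0 (resO h)) -(rmorph0 (pull p U)).
rewrite derivD derivC addr0 derivM derivX mulr1 !ch_evalD !ch_evalMX ch_evalC.
rewrite !rmorphD !rmorphM dD dM /=.
have Npa := Na a; set D := resO h (ev q^`()) in IH *.
move: (resO h T) (resO h (ev q)) (dif OmY _) IH Npa => t x dt IH Npa.
rewrite (_ : _ - _ = t *: (dt - D *: dif OmY t) + dif OmY (resO h (pl a))).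
  exact: NL.
rewrite scalerDl scalerBr scalerA [D * t]mulrC opprD [_ *: _ + t *: dt]addrC addrAC.
by rewrite [- _ - _]addrC addrA addrK addrAC.
Qed.

(** Vanishing of the relative differentials, in submodule form: chi(T) = 0 puts chi'(T) dT in [N],
    hence dT as chi'(T) is a unit, hence every dg as g is a polynomial in T. *)
Lemma unramified (OmY : cotangent Y) (v : OO Y (pre p U)) :
  (forall g, exists q, ev q = g) -> ev (ch_poly c) = 0 ->
  v * ev (ch_poly c)^`() = 1 ->
  forall V (h : V <=o pre p U) (N : set (OmY V)),
  N 0 -> (forall a m n, N m -> N n -> N (a *: m + n)) ->
  (forall a, N (dif OmY (resO h (pull p U a)))) ->
  forall g, N (dif OmY (resO h g)).
Proof.
move=> gen rt vP V h N N0 NL Na g.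
have dif0 : dif OmY (0 : OO Y V) = 0.
  by have [dD _ _] := dif_der OmY V; apply: (addrI (dif OmY 0)); rewrite -dD !addr0.
have NT : N (dif OmY (resO h T)).
  have := ch_eval_dif (h := h) (ch_poly c) N0 NL Na.
  rewrite rt rmorph0 dif0 sub0r -scaleNr => NT.
  rewrite -[dif OmY _]scale1r -(rmorph1 (resO h)) -vP rmorphM.
  by rewrite -[X in X *: _]opprK -mulrN -mulNr -scalerA -[X in N X]addr0; apply: NL.
have [q <-] := gen g.
have := NL (resO h (ev q^`())) _ _ NT (ch_eval_dif (h := h) q N0 NL Na).
by rewrite addrC subrK.
Qed.

End ChartEval.

Section Charts.
Variables (k : fieldType) (X : ringed_space k) (Om : cotangent X) (E : pmod X).
Variables (theta : mor E (tensor Om E)) (r : nat) (c : chart theta r).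

Lemma contract_res U V (h : V <=o U) (t : dual Om U) (e : E U) :
  res E h (contract theta t e) = contract theta (res (dual Om) h t) (res E h e).
Proof.
rewrite /contract (hom_nat (ap theta e) (subo_refl U) h h) -ap_res /=.
exact: (homs_irr (ap theta e)).
Qed.

Variables (V : opens X) (h : V <=o ch_open c) (nz : (1 : OO X V) != 0).

Let rho := nzmorph (ch_nz c) nz (resO h).

Fact chart_res_subproof j :
  contract theta (res (dual Om) h (ch_coord c)) (res E h (ch_frame c j))
    = \sum_(i < r) (map_mx rho (ch_mat c) i j : OO X V) *: res E h (ch_frame c i).
Proof.
rewrite -contract_res ch_matP raddf_sum; apply: eq_bigr => i _.
by rewrite resZ mxE.
Qed.

(** [is_spectral_curve] speaks of charts over affine opens, so a given chart has to be shrunk to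
    one. *)
Definition chart_res : chart theta r :=
  @Chart _ _ _ _ theta r V nz _ (frame_res h (@ch_frameP _ _ _ _ _ _ c)) _
    (generator_res h (@ch_coordP _ _ _ _ _ _ c)) _
    chart_res_subproof.

Lemma ch_poly_res : ch_poly chart_res = map_poly rho (ch_poly c).
Proof. by rewrite /ch_poly map_char_poly. Qed.

(** The resultant of chi and chi' lies in the ideal they generate, provided both are nonconstant.
    For r >= 2 this holds because chi' has the nonzero coefficient r in degree r - 1; for r = 0 and
    r = 1 one of chi, chi' is 1, whence the alternative d = 1. *)
Lemma ch_disc_bezout : (forall n, n.+1%:R != 0 :> k) ->
  exists u v (d : nzring (ch_nz c)), d%:P = u * ch_poly c + v * (ch_poly c)^`() /\
    (d = ch_disc c \/ d = 1).
Proof.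
move=> chark; have sz : size (ch_poly c) = r.+1 by rewrite size_char_poly.
have mon : ch_poly c \is monic := char_poly_monic _.
have lead : (ch_poly c)`_r = 1 by have /eqP := mon; rewrite /lead_coef sz.
have [r0|] := leqP r 0.
  exists 1, 0, 1; split; last by right.
  rewrite mul0r addr0 mul1r (size1_polyC (p := ch_poly c)) ?sz //.
  have r0' : 0%N = r by apply/esym/eqP; rewrite -leqn0.
  by rewrite [in (_)`_0]r0' lead.
rewrite leq_eqVlt => /orP[/eqP r1|r2].
  exists 0, 1, 1; split; last by right.
  rewrite mul0r add0r mul1r (size1_polyC (p := _^`())).
    by rewrite coef_deriv [in (_)`_1]r1 lead.
  by rewrite /deriv; apply: leq_trans (size_poly _ _) _; rewrite sz -r1.
have dn0 : ((ch_poly c)^`())`_r.-1 != 0.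
  rewrite coef_deriv prednK ?(ltnW r2) // lead.
  apply/eqP => e; have := ch_nz c; rewrite -(rmorph1 (cst (ch_open c))).
  have r0 : (r%:R : k) != 0 by case: (r) r2.
  rewrite -(divff r0) rmorphM rmorph_nat.
  have -> : r%:R = 0 :> OO X (ch_open c) by [].
  by rewrite mul0r eqxx.
have [||[u v] [_ _ E0]] := @resultant_in_ideal _ (ch_poly c) (ch_poly c)^`().
- by rewrite sz; case: (r) r2.
- rewrite ltnNge; apply/negP => le; case/eqP: dn0.
  by rewrite nth_default //; apply: leq_trans le _; case: (r) r2 => [|[]].
by exists u, v, (ch_disc c); split; [|left].
Qed.

End Charts.

Section FormPullback.
Variables (k : fieldType) (X Y : ringed_space k) (p : morphism Y X).
Variables (OmX : cotangent X) (OmY : cotangent Y).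
Variables (dp : mor OmX (push p OmY)) (hdp : is_form_pullback dp).

Lemma form_pullbackZ U a (w : OmX U) :
  (ap dp (a *: w) : OmY (pre p U)) = pull p U a *: (ap dp w : OmY (pre p U)).
Proof. by rewrite apZ. Qed.

(* Where OmY has a generator eta, dp w = f eta; the multiples of dp w contain all
   differentials, hence eta, so f is a unit. *)
Lemma form_generator U (w : OmX U) :
  is_sheaf (Omod Y) -> locally_free OmY 1 -> is_generator w -> affine (pre p U) ->
  (forall V (h : V <=o pre p U) (N : set (OmY V)),
    N 0 -> (forall a m n, N m -> N n -> N (a *: m + n)) ->
    (forall a, N (dif OmY (resO h (pull p U a)))) ->
    forall g, N (dif OmY (resO h g))) ->
  is_generator (ap dp w : OmY (pre p U)).
Proof.
move=> shO lO gw aW unr; set W := pre p U; set dw : OmY W := ap dp w.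
apply: (generator_local shO); first exact: Om_sheaf.
move=> y Wy; have [V1 [eta1 [V1y geta1]]] := locally_free_generator y lO.
have [f [fy fV1]] := affine_base aW V1y Wy.
set V := basic_open f; have hV : V <=o W := basic_sub f.
have geta := generator_res fV1 geta1; move: (res OmY fV1 eta1) geta => eta geta.
exists V, hV; split=> //.
pose N : set (OmY V) := [set n | exists a, n = a *: res OmY hV dw].
have N0 : N 0 by exists 0; rewrite scale0r.
have NL a m n : N m -> N n -> N (a *: m + n).
  by move=> [b ->] [b' ->]; exists (a * b + b'); rewrite scalerDl scalerA.
have NZ a m : N m -> N (a *: m) by move=> Nm; rewrite -[_ *: m]addr0; apply: NL.
have Na a : N (dif OmY (resO hV (pull p U a))).
  have [al Eal] := generator_span (subo_refl U) (dif OmX a) gw.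
  exists (resO hV (pull p U al)).
  by rewrite -dif_res -hdp Eal res_id form_pullbackZ resZ.
have Ng := unr V hV N N0 NL Na.
have [e fe] := basic_unit f shO.
(* A function b on D(f) satisfies f^n b = g with g from [W]; then f^n db = dg - b d(f^n) lies in
   [N], and f is invertible. *)
have Nd b : N (dif OmY b).
  have [n [g Eg]] := basic_frac b aW.
  have [_ dM _] := dif_der OmY V.
  have En : e ^+ n * resO hV f ^+ n = 1.
    by rewrite -exprMn mulrC (Prop_irrelevance hV (basic_sub f)) fe expr1n.
  rewrite -[dif OmY b]scale1r -En -scalerA; apply: (NZ).
  have := Ng g; rewrite (Prop_irrelevance hV (basic_sub f)) -Eg dM.
  set m := b *: _; move=> Nm; rewrite -[X in N X](addrK m) addrC -scaleN1r.
  apply: NL => //; apply: (NZ).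
  by rewrite -rmorphXn (Prop_irrelevance (basic_sub f) hV).
have [b Eb] : N eta := dif_span N0 NL (affine_basic f shO aW) Nd eta.
have [a Ea] := generator_span (subo_refl V) (res OmY hV dw) geta.
rewrite res_id in Ea; rewrite Ea; apply: (generator_unit (g := b)) => //.
apply: (generator_inj (h := subo_refl V) geta).
by rewrite res_id mulrC -scalerA -Ea -Eb scale1r.
Qed.

End FormPullback.

Section EtaleLocus.
Variables (k : fieldType) (X Y : ringed_space k) (p : morphism Y X).
Variables (OmX : cotangent X) (OmY : cotangent Y).
Variables (E : pmod X) (theta : mor E (tensor OmX E)) (r : nat).
Variable lam : mor (dual OmX) (push p (Omod Y)).
Variables (dp : mor OmX (push p OmY)) (hdp : is_form_pullback dp).

(** [U] is a basic open of an affine open, small enough to lie in the chart, in the open where the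
    discriminant has an inverse, and in an open where Omega_X has a generator. This generator w is
    chosen independently of [ch_coord]. *)
Lemma etale_nbhd x : (forall n, n.+1%:R != 0 :> k) ->
  smooth_curve OmX -> smooth_curve OmY -> is_spectral_curve theta lam r ->
  oset (etale_locus theta r) x ->
  exists U (w : OmX U), [/\ oset U x, U <=o etale_locus theta r, is_generator w,
    affine (pre p U) & is_generator (ap dp w : OmY (pre p U))].
Proof.
move=> chark [[shOX affX] _ lX] [[shOY _] _ lY] hspec [c [cx [V0 [h0 [V0x [g0 g0P]]]]]].
have [U1 [U1x aU1]] := affX x.
have [U2 [w2 [U2x gw2]]] := locally_free_generator x lX.
have [f [fx fV]] := affine_base (V := ocap V0 U2) aU1 (conj V0x U2x) U1x.
set U := basic_open f in fx fV.
have aU : affine U := affine_basic f shOX aU1.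
have hc : U <=o ch_open c by move=> u /fV[/h0].
have hU2 : U <=o U2 by move=> u /fV[].
have hV0 : U <=o V0 by move=> u /fV[].
have gw := generator_res hU2 gw2; move: (res OmX hU2 w2) gw => w gw.
(* A chart needs a nonzero ring. The point x of [U] provides it, as 0 is a unit at no point of an
   affine open. *)
have nz : (1 : OO X U) != 0.
  apply/eqP => E1; apply: (affine_nonunit0 aU fx); rewrite -E1; exact: unit_at1.
have [aW gen ev0] := hspec (chart_res hc nz) aU.
exists U, w; split=> //.
  move=> u Uu; exists c; split; first exact (hc u Uu).
  exists V0, h0; split; [exact (hV0 u Uu)|by exists g0].
apply: (form_generator hdp shOY lY gw aW).
have [u [v [d [uvP dP]]]] := ch_disc_bezout c chark.
have [e eP] : exists e, resO hc d * e = 1.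
  case: dP => ->; last by exists 1; rewrite rmorph1 mulr1.
  exists (resO hV0 g0).
  by rewrite -(resO_comp h0 hV0 hc) -rmorphM g0P rmorph1.
pose c' := chart_res hc nz.
have rt : ch_eval lam (ch_poly c') = 0 by apply/ev0; exists 1; rewrite mul1r.
(* Over [U], evaluation at T kills the multiple of chi and leaves d = v(T) chi'(T), so e v(T) is the
   inverse of chi'(T). *)
have /= := congr1 (map_poly (nzmorph (ch_nz c) nz (resO hc))) uvP.
rewrite rmorphD !rmorphM /= -(ch_poly_res hc nz) map_polyC /= -deriv_map -(ch_poly_res hc nz).
move=> /(congr1 (ch_eval (c := c') lam)).
rewrite ch_evalD !ch_evalM rt mulr0 add0r ch_evalC.
move=> E1.
apply: (unramified (c := c') (v := pull p U e * ch_eval lam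
  (map_poly (nzmorph (ch_nz c) nz (resO hc)) v : {poly nzring (ch_nz c')}))) => //.
rewrite -mulrA -E1 mulrC.
have := congr1 (pull p U) eP; rewrite rmorphM rmorph1; exact.
Qed.

End EtaleLocus.

(** * The spectral Atiyah class *)

Section Transport.
Variables (k : fieldType) (X Y : ringed_space k) (p : morphism Y X).
Variables (OmX : cotangent X) (OmY : cotangent Y).
Variables (dp : mor OmX (push p OmY)) (hdp : is_form_pullback dp).

Lemma tens_generator_inj (Z : ringed_space k) (M N : pmod Z) U (w : M U) V
    (h : V <=o U) (n n' : N V) :
  is_generator w -> tens (res M h w) n = tens (res M h w) n' -> n = n'.
Proof.
move=> gw E; have [t0 t0P] := dual_generator (generator_res h gw).
have := congr1 (fun f : tensor M N V => f V (subo_refl V) t0) E.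
rewrite !tensE !(res_id _ n) !(res_id _ n').
by have := t0P V (subo_refl V) 1; rewrite scale1r => ->; rewrite !scale1r.
Qed.

Lemma tens_surj (Z : ringed_space k) (M N : pmod Z) U (w : M U) V
    (h : V <=o U) (s : tensor M N V) :
  is_generator w -> exists n, s = tens (res M h w) n.
Proof.
move=> gw; have [t0 t0P] := dual_generator gw.
by eexists; apply: (tensor_decomp h s gw t0P).
Qed.

(** Serves the points outside the open under consideration, to which a cover still has to assign an
    open. *)
Lemma empty_generator (Z : ringed_space k) (M : pmod Z) U :
  is_sheaf (Omod Z) -> is_sheaf M -> (forall x, ~ oset U x) ->
  is_generator (0 : M U).
Proof.
move=> shO shM U0; apply/generatorP; split=> V h n.
  by exists 0; apply: sheaf_empty => // x /h /U0.
by move=> _; apply: (@sheaf_empty _ _ (Omod Z)) => // x /h /U0.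
Qed.

(** D e = w (x) f, where nabla(phi e) = dp w (x) phi(f); such an f exists and is unique because dp w
    generates and [phi] is bijective. The conclusion keeps f for the comparison of two such
    connections. *)
Lemma transport_connection (E : pmod X) (L : pmod Y) (phi : mor E (push p L))
    U (w : OmX U) (nab : homs L (jet OmY L) (pre p U)) :
  is_iso phi -> is_generator w -> is_generator (ap dp w : OmY (pre p U)) ->
  is_connection nab ->
  exists2 sg : homs E (jet OmX E) U, is_connection sg &
    forall V (h : V <=o U) (e : E V), exists2 f : E V,
      conn nab (pre_sub h) (ap phi e : L (pre p V))
        = tens (res OmY (pre_sub h) (ap dp w : OmY (pre p U))) (ap phi f : L (pre p V)) &
      conn sg h e = tens (res OmX h w) f.
Proof.
move=> iso gw; set dw : OmY (pre p U) := ap dp w => gdw cn.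
have phi_inj V : injective (@ap _ _ _ _ phi V) := bij_inj (iso V).
have ex V (h : V <=o U) (e : E V) : exists f : E V,
    conn nab (pre_sub h) (ap phi e : L (pre p V))
      = tens (res OmY (pre_sub h) dw) (ap phi f : L (pre p V)).
  have [n ->] := tens_surj (pre_sub h) (conn nab (pre_sub h) (ap phi e : L (pre p V))) gdw.
  have [g _ gK] := iso V; by exists (g n); rewrite gK.
pose F V h e := sval (cid (@ex V h e)).
have FP V h e : conn nab (pre_sub h) (ap phi e : L (pre p V))
      = tens (res OmY (pre_sub h) dw) (ap phi (F V h e) : L (pre p V)).
  exact: (svalP (cid (@ex V h e))).
have FU V h e f : conn nab (pre_sub h) (ap phi e : L (pre p V))
      = tens (res OmY (pre_sub h) dw) (ap phi f : L (pre p V)) -> F V h e = f.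
  by rewrite FP => /(tens_generator_inj gdw)/phi_inj.
clearbody F.
have dwE V (h : V <=o U) : res OmY (pre_sub h) dw = ap dp (res OmX h w).
  by rewrite -(ap_res dp h).
pose D V (h : V <=o U) e := tens (res OmX h w) (F V h e).
have [||sg cs sgE] := @build_connection _ _ OmX E U D.
- move=> V h a e e'; rewrite /D.
  (* From da = al w follows d(p^* a) = p^*(al) dp w, so the Leibniz rule of nabla becomes F(a e) = a
     F(e) + al e. *)
  have [al Eal] := generator_span h (dif OmX a) gw.
  rewrite (FU _ _ _ (a *: F V h e + al *: e + F V h e')).
    by rewrite !tensDr !tensZr Eal tensZl.
  have phiZ b (x : E V) : (ap phi (b *: x) : L (pre p V)) = pull p V b *: (ap phi x : L (pre p V)).
    by rewrite apZ.
  have phiD (x y : E V) :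
      (ap phi (x + y) : L (pre p V)) = (ap phi x : L (pre p V)) + (ap phi y : L (pre p V)).
    by rewrite apD.
  rewrite !phiD !phiZ connD connZ // !FP !tensDr !tensZr; congr (_ + _ + _).
  by rewrite -hdp Eal (form_pullbackZ dp) tensZl dwE.
- move=> V V' h h' h'' e; rewrite /D.
  rewrite -[LHS]/(res (tensor OmX E) h' (tens _ _)) res_tens (res_comp h h' h''); congr tens.
  apply/esym/FU.
  have phiR x : (ap phi (res E h' x) : L (pre p V')) = res L (pre_sub h') (ap phi x : L (pre p V)).
    by rewrite -(ap_res phi h').
  rewrite !phiR -(conn_res nab (pre_sub h) (pre_sub h') (pre_sub h'')) FP.
  by rewrite res_tens (res_comp (pre_sub h) (pre_sub h') (pre_sub h'')).
by exists sg => // V h e; exists (F V h e).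
Qed.

Variables (psi : mor (tensor OmX (push p (Omod Y))) (push p OmY)).
Hypothesis hpsi : is_form_projection dp psi.

(** In terms of the generators, [psi] sends w (x) g to g dp w: it is the identity on the
    coefficients g. *)
Lemma form_projection_bij W : is_sheaf (Omod Y) ->
  (forall x, oset W x -> exists U (w : OmX U), [/\ oset U x, is_generator w &
     is_generator (ap dp w : OmY (pre p U))]) ->
  bij_over psi W.
Proof.
move=> shO loc; apply: bij_over_local.
- exact/Hom_sheaf/push_sheaf.
- exact/push_sheaf/Om_sheaf.
move=> x Wx; have [U [w [Ux gw gdw]]] := loc x Wx; exists U; split=> // V h.
have psiE (g : OO Y (pre p V)) :
    (ap psi (tens (res OmX h w) (g : push p (Omod Y) V)) : OmY (pre p V))
      = g *: res OmY (pre_sub h) (ap dp w : OmY (pre p U)).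
  by rewrite hpsi -(ap_res dp h).
split=> [s|n].
  have [g ->] := tens_surj h s gw => /= g0.
  have /generatorP[_ fr] := gdw.
  have -> : g = 0; last exact: tens0.
  by apply: (fr _ (pre_sub h)); rewrite -psiE.
have [g Eg] := generator_span (pre_sub h) (n : OmY (pre p V)) gdw.
by exists (tens (res OmX h w) (g : push p (Omod Y) V)); rewrite {1}Eg; exact: psiE.
Qed.

End Transport.

Section SpectralAtiyahClass.
Variables (k : fieldType) (X : ringed_space k) (OmX : cotangent X).
Variables (E : pmod X) (Y : ringed_space k) (p : morphism Y X) (OmY : cotangent Y).
Variables (L : pmod Y) (hL : line_bundle L) (phi : mor E (push p L)).
Hypothesis phi_iso : is_iso phi.
Variables (m : mor (push p (Omod Y)) (EndM E)) (hm : is_multiplication phi m).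
Variables (dp : mor OmX (push p OmY)) (hdp : is_form_pullback dp).
Variables (psi : mor (tensor OmX (push p (Omod Y))) (push p OmY)).
Hypothesis hpsi : is_form_projection dp psi.
Hypotheses (shOX : is_sheaf (Omod X)) (shOY : is_sheaf (Omod Y)).
Hypothesis lOmY : locally_free OmY 1.

(* In terms of generators w of OmX and dp w of OmY, the transported connections
   satisfy D_y e - D_x e = w (x) g e if nabla_y - nabla_x = g dp w. *)
Lemma transport_diff U U' (w : OmX U) (w' : OmX U') V (h : V <=o U) (h' : V <=o U')
    (c : tensor OmX (push p (Omod Y)) V) (t : dual OmX V) (e f f' : E V) :
  is_generator w -> is_generator (ap dp w : OmY (pre p U)) ->
  tens (res OmY (pre_sub h') (ap dp w' : OmY (pre p U'))) (ap phi f' : L (pre p V))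
  - tens (res OmY (pre_sub h) (ap dp w : OmY (pre p U))) (ap phi f : L (pre p V))
    = tens (ap psi c : OmY (pre p V)) (ap phi e : L (pre p V)) ->
  ap m (c V (subo_refl V) t) V (subo_refl V) e
    = (tens (res OmX h' w') f' - tens (res OmX h w) f) V (subo_refl V) t.
Proof.
move=> gw gdw; have phi_inj V' : injective (@ap _ _ _ _ phi V') := bij_inj (phi_iso V').
have phiZ b (x : E V) : (ap phi (b *: x) : L (pre p V)) = pull p V b *: (ap phi x : L (pre p V)).
  by rewrite apZ.
have phiB (x y : E V) :
    (ap phi (x - y) : L (pre p V)) = (ap phi x : L (pre p V)) - (ap phi y : L (pre p V)).
  by rewrite apB.
(* Both forms are expressed through the single generator w, by w' = a w on [V]. *)
have [a Ea] := generator_span h (res OmX h' w') gw.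
have [g Eg] := tens_surj h c gw.
have dwE V1 V2 (h1 : V2 <=o V1) (v : OmX V1) :
    res OmY (pre_sub h1) (ap dp v : OmY (pre p V1)) = ap dp (res OmX h1 v).
  by rewrite -(ap_res dp h1).
have psiE :
    (ap psi c : OmY (pre p V)) = (g : OO Y (pre p V)) *: (ap dp (res OmX h w) : OmY (pre p V)).
  by rewrite Eg hpsi.
rewrite !dwE Ea (form_pullbackZ dp) psiE !tensZl -!tensZr => Eq.
have {}Eq : pull p V a *: (ap phi f' : L (pre p V)) - (ap phi f : L (pre p V))
    = (g : OO Y (pre p V)) *: (ap phi e : L (pre p V)).
  apply: (tens_generator_inj (h := pre_sub h) gdw); rewrite dwE -Eq.
  exact: tensBr.
apply: (phi_inj V).
have -> : ap phi (ap m (c V (subo_refl V) t) V (subo_refl V) e) =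
   resO (pre_sub (subo_refl V)) (c V (subo_refl V) t : OO Y (pre p V)) *: (ap phi e : L (pre p V)).
  exact: hm.
rewrite resO_id Eg tensE /= !res_id.
rewrite /pair_dual res_id -scalerBr phiZ phiB phiZ Eq scalerA.
by [].
Qed.

(** The image of the spectral cocycle under id (x) m and the restriction of a cocycle of E on X both
    consist of differences of connections on E over opens of [W], hence are cohomologous. *)
Lemma spectral_atiyah (W : opens X) r :
  locally_free E r ->
  (forall x, oset W x -> exists U (w : OmX U), [/\ oset U x, U <=o W, is_generator w,
    affine (pre p U) & is_generator (ap dp w : OmY (pre p U))]) ->
  H1_map (tensor_map OmX m) (beta_spec W psi L)
    = H1_res (sub_otop W) (atiyah OmX (otop X) E).
Proof.
move=> lE loc.
pose good (U : opens X) (w : OmX U) (nab : homs L (jet OmY L) (pre p U)) :=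
  [/\ U <=o W, is_generator w, is_generator (ap dp w : OmY (pre p U)) &
    is_connection nab].
(* A cover is indexed by all points of X. Those outside [W] receive the empty open, where 0 is a
   generator and the zero map a connection. *)
have ex x : exists U (w : OmX U) nab, (oset W x -> oset U x) /\ @good U w nab.
  have [Wx|Wx] := pselect (oset W x).
    have [U [w [Ux UW gw aU gdw]]] := loc x Wx.
    have [nab cn] := affine_connection shOY lOmY hL aU gdw.
    by exists U, w, nab.
  pose U0 : opens X := Opens open0.
  have gw : is_generator (0 : OmX U0).
    by apply: (empty_generator shOX (@Om_sheaf _ _ OmX)) => y [].
  exists U0, 0, 0; split=> //; split=> //.
    rewrite /ap homs0.
    by apply: (@empty_generator _ _ OmY (pre p U0) shOY (@Om_sheaf _ _ OmY)) => y [].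
  by move=> V h e; apply: (@sheaf_empty _ _ L V _ e hL.1) => y /h [].
have {ex} [U [w [nab [UW_in gd]]]] : exists (U : X -> opens X) (w : forall x, OmX (U x))
    (nab : forall x, homs L (jet OmY L) (pre p (U x))),
    (forall x, oset W x -> oset (U x) x) /\ forall x, good (U x) (w x) (nab x).
  exists (fun x => projT1 (cid (ex x))).
  exists (fun x => projT1 (cid (projT2 (cid (ex x))))).
  exists (fun x => projT1 (cid (projT2 (cid (projT2 (cid (ex x))))))).
  by split=> x; case: (projT2 (cid (projT2 (cid (projT2 (cid (ex x))))))).
have UW x : U x <=o W by case: (gd x).
have gw x : is_generator (w x) by case: (gd x).
have gdw x : is_generator (ap dp (w x) : OmY (pre p (U x))) by case: (gd x).
have cn x : is_connection (nab x) by case: (gd x).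
have psi_bij : bij_over psi W.
  apply: (form_projection_bij hpsi shOY) => x Wx.
  by exists (U x), (w x); split=> //; apply: UW_in.
have [d [dP dlaw]] := line_conn_diffs shOY lOmY hL cn.
(* The preimage of the intersection and the intersection of the preimages have the same points but
   are different terms. *)
have sp x y : pre p (ocap (U x) (U y)) <=o ocap (pre p (U x)) (pre p (U y)) by [].
have sW x y : ocap (U x) (U y) <=o W by move=> u [/UW].
have [c cP] : exists c : forall x y, tensor OmX (push p (Omod Y)) (ocap (U x) (U y)),
    forall x y, (ap psi (c x y) : OmY _) = res OmY (sp x y) (d x y).
  have sur x y := (psi_bij _ (sW x y)).2 (res OmY (sp x y) (d x y)).
  by exists (fun x y => sval (cid (sur x y))) => x y; exact: (svalP (cid (sur x y))).
have claw x y z V (hxy : V <=o ocap (U x) (U y)) (hyz : V <=o ocap (U y) (U z))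
    (hxz : V <=o ocap (U x) (U z)) :
    res (tensor OmX (push p (Omod Y))) hxy (c x y)
    + res (tensor OmX (push p (Omod Y))) hyz (c y z)
    = res (tensor OmX (push p (Omod Y))) hxz (c x z).
  apply: (bij_over_inj psi_bij); first exact: subset_trans hxy (sW x y).
  have R u v (h : V <=o ocap (U u) (U v)) :
      (ap psi (res (tensor OmX (push p (Omod Y))) h (c u v)) : OmY (pre p V))
      = res OmY (subset_trans (pre_sub h) (sp u v)) (d u v).
    transitivity (res OmY (pre_sub h) (ap psi (c u v) : OmY (pre p (ocap (U u) (U v))))).
      by rewrite -(ap_res psi h).
    by rewrite cP; apply: res_comp.
  by rewrite apD !R; apply: dlaw.
pose c0 : cocycle W (tensor OmX (push p (Omod Y))) := Cocycle UW UW_in claw.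
have specE : H1_spec psi (H1_class c0) = H1_class (coc_pull (coc_map psi c0)).
  by rewrite /H1_spec H1_map_class H1_pull_class.
have send_bij V : bij_over (scalar_end OmY L) V := scalar_end_bij shOY lOmY hL.
have atL : atiyah OmY (pre p W) L = H1_map (scalar_end OmY L) (H1_spec psi (H1_class c0)).
  rewrite specE H1_map_class; apply: atiyah_class; apply/atiyah_cocycleP.
  (* The pulled-back cover is indexed by points y of Y, with open p^-1 U_{p y}, so the connection at
     y is the one chosen at p y. *)
  exists (fun y => nab (p y)); split=> [y|x y V h hx hy t e]; first exact: cn.
  rewrite (dP _ _ V _ hx hy) /=.
  rewrite resO_id /pair_dual !res_id cP; congr (t V _ _ *: _).
  by rewrite (res_comp (sp _ _) _ (subo_refl _)) res_id.
have lineE : atiyah_line OmY (pre p W) L = H1_spec psi (H1_class c0).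
  apply: xget_unique => [|b]; first exact: esym.
  by rewrite /= atL => /(H1_map_inj (send_bij _)).
have betaE : beta_spec W psi L = H1_class c0.
  apply: xget_unique => [|b]; first exact: esym.
  rewrite /= lineE /H1_spec => /(H1_pull_inj (@Om_sheaf _ _ OmY)).
  exact: H1_map_inj.
rewrite betaE H1_map_class.
(* At(E) is the class of an actual cocycle, since E has connections near every point; it remains to
   compare two cocycles of connection differences. *)
have [cE aE] := atiyah_cocycle_exists OmX lE.
rewrite (atiyah_class aE) H1_res_class; apply/H1_classP.
apply: atiyah_cocycle_cohom; last exact: atiyah_cocycle_res.
have exE x := transport_connection hdp phi_iso (gw x) (gdw x) (cn x).
pose sg x := s2val (cid2 (exE x)).
have cs x : is_connection (sg x) := s2valP (cid2 (exE x)).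
have sgP x := s2valP' (cid2 (exE x)).
apply/atiyah_cocycleP; exists sg; split=> // x y V h hx hy t e.
have [f Ef Df] := sgP x V hx e; have [f' Ef' Df'] := sgP y V hy e.
rewrite Df Df'.
transitivity (ap m (res (tensor OmX (push p (Omod Y))) h (c x y)
  V (subo_refl V) t) V (subo_refl V) e).
  by rewrite /= (homs_irr (c x y) (subset_trans (subo_refl V) h) h).
apply: (transport_diff (U := U x) (U' := U y)) => //.
rewrite -Ef -Ef'.
rewrite (dP x y _ (subset_trans (pre_sub h) (sp x y))); congr tens.
have -> : (ap psi (res (tensor OmX (push p (Omod Y))) h (c x y)) : OmY (pre p V))
  = res OmY (pre_sub h) (ap psi (c x y) : OmY (pre p (ocap (U x) (U y)))).
  by rewrite -(ap_res psi h).
by rewrite cP; apply/esym/res_comp.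
Qed.

End SpectralAtiyahClass.

Theorem theorem3p3 (R : realType)
  (X : ringed_space R[i]) (OmX : cotangent X)
  (hX : smooth_projective_curve OmX)
  (r : nat) (E : pmod X) (hE : vector_bundle E r)
  (theta : mor E (tensor OmX E))
  (hrss : regular_semisimple theta r)
  (Y : ringed_space R[i]) (p : morphism Y X)
  (lam : mor (dual OmX) (push p (Omod Y)))
  (hspec : is_spectral_curve theta lam r)
  (OmY : cotangent Y) (hY : smooth_curve OmY)
  (L : pmod Y) (hL : line_bundle L)
  (phi : mor E (push p L)) (hphi : is_spectral_bundle theta lam phi)
  (m : mor (push p (Omod Y)) (EndM E)) (hm : is_multiplication phi m)
  (dp : mor OmX (push p OmY)) (hdp : is_form_pullback dp)
  (psi : mor (tensor OmX (push p (Omod Y))) (push p OmY))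
  (hpsi : is_form_projection dp psi) :
  let X0 := etale_locus theta r in
  H1_map (tensor_map OmX m) (beta_spec X0 psi L)
    = H1_res (sub_otop X0) (atiyah OmX (otop X) E).
Proof.
have [sX _ _] := hX; have [[shOX _] _ _] := sX; have [[shOY _] _ lY] := hY.
have [iso _] := hphi; have [_ lE] := hE.
move=> X0; apply: (spectral_atiyah hL iso hm hdp hpsi shOX shOY lY (W := X0) lE) => x X0x.
apply: (etale_nbhd hdp _ sX hY hspec X0x) => n.
by rewrite Num.Theory.pnatr_eq0.
Qed.
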